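(* There is an algorithm that, given a string $w[1..n]$ over a totally ordered alphabet together with its suffix array $\mathsf{SA}$ and longest common prefix array $\mathsf{LCP}$, correctly computes the $\mathcal{MRC}$ array of $w$ in $\mathcal{O}(n\log n)$ time and $\mathcal{O}(n)$ auxiliary space.
   Context: Strings are indexed from 1; $w[i..j]$ denotes the substring (occurrence) from position $i$ to $j$. A border of a string $x$ is a nonempty string that is both a proper prefix and a proper suffix of $x$. A string $x$ is closed if $|x|=1$, or $|x|\ge2$ and $x$ has a border occurring in $x$ only as a prefix and as a suffix and nowhere else. An occurrence $w[i..j]$ is maximal right-closed if it is closed and either $j=n$ or $w[i..j+1]$ is not closed. For a position $i$, let $r_1,\ldots,r_{K_i}$ be the maximal right-closed occurrences starting at $i$ with $|r_1|<\cdots<|r_{K_i}|$, and let $b_j$ be the longest border of $r_j$ ($|b_j|=0$ if $|r_j|=1$). The $\mathcal{MRC}$ array of $w$ is the array of length $n$ whose entry $\mathcal{MRC}[i]$ is the list of pairs $(|r_j|,|b_j|)$ for $j=K_i$ down to $1$. The suffix array $\mathsf{SA}[1..n]$ lists the starting positions of the suffixes of $w$ in lexicographically increasing order; $\mathsf{LCP}[1]=0$ and $\mathsf{LCP}[i]$, for $2\le i\le n$, is the length of the longest common prefix of the suffixes starting at $\mathsf{SA}[i-1]$ and $\mathsf{SA}[i]$. *)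

(* Defs.v *)
From HB Require Import structures.
From mathcomp Require Import all_boot all_order.
Set Implicit Arguments.
Unset Strict Implicit.
Unset Printing Implicit Defensive.

(* Positions are 1-based: entry i of an array s is [nth x0 s i.-1]. *)
Definition entry (T : Type) (x0 : T) (s : seq T) (i : nat) : T := nth x0 s i.-1.

Definition substr (A : Type) (w : seq A) (i j : nat) : seq A :=
  take (j.+1 - i) (drop i.-1 w).

Definition suffix_at (A : Type) (w : seq A) (i : nat) : seq A := drop i.-1 w.

(* Only used with u nonempty. *)
Definition occurs_at (A : eqType) (u x : seq A) (k : nat) : bool :=
  (0 < k) && prefix u (suffix_at x k).

Definition border (A : eqType) (u x : seq A) : bool :=
  [&& u != [::], size u < size x, prefix u x & suffix u x].

Definition closed_string (A : eqType) (x : seq A) : Prop :=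
  size x = 1 \/
  (2 <= size x /\
   exists u : seq A, border u x /\
     forall k, occurs_at u x k -> k = 1 \/ k = (size x - size u).+1).

Definition maximal_right_closed (A : eqType) (w : seq A) (i j : nat) : Prop :=
  [/\ 1 <= i <= j, j <= size w, closed_string (substr w i j) &
      j = size w \/ ~ closed_string (substr w i j.+1)].

Definition longest_border_length (A : eqType) (x : seq A) (b : nat) : Prop :=
  (size x = 1 /\ b = 0) \/
  (2 <= size x /\
   exists u : seq A, [/\ border u x, size u = b &
     forall v, border v x -> size v <= b]).

(* The strict decrease of the lengths makes each entry of M unique. *)
Definition is_MRC_array (A : eqType) (w : seq A) (M : seq (seq (nat * nat))) :
    Prop :=
  size M = size w /\
  forall i, 1 <= i <= size w ->
    sorted (fun p q : nat * nat => q.1 < p.1) (entry [::] M i) /\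
    forall l b : nat,
      (l, b) \in entry [::] M i <->
      [/\ 1 <= l, maximal_right_closed w i (i + l).-1 &
          longest_border_length (substr w i (i + l).-1) b].

Definition lex_lt (d : Order.disp_t) (A : orderType d) (s t : seq A) : bool :=
  ((s : seqlexi A) < (t : seqlexi A))%O.

Definition is_suffix_array (d : Order.disp_t) (A : orderType d)
    (w : seq A) (SA : seq nat) : Prop :=
  perm_eq SA (iota 1 (size w)) /\
  sorted (fun p q => lex_lt (suffix_at w p) (suffix_at w q)) SA.

Fixpoint common_prefix_length (A : eqType) (s t : seq A) : nat :=
  match s, t with
  | x :: s', y :: t' => if x == y then (common_prefix_length s' t').+1 else 0
  | _, _ => 0
  end.

Definition is_lcp_array (A : eqType) (w : seq A) (SA LCP : seq nat) : Prop :=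
  [/\ size LCP = size w,
      entry 0 LCP 1 = 0 &
      forall i, 2 <= i <= size w ->
        entry 0 LCP i =
        common_prefix_length (suffix_at w (entry 0 SA i.-1))
                             (suffix_at w (entry 0 SA i))].

(* Algorithms are programs of a word RAM, presented as a structured language:
   - the input (n, w, SA, LCP) is read-only, and the letters of w can only be
     compared with each other;
   - the working memory consists of arrays of words, named by the numbers that
     occur in the program (so there are finitely many of them) and initially
     filled with zeros; a scalar variable is an array of length 1;
   - the output is a write-only array of n linked lists of pairs of words,
     initially empty; a pair can be inserted at either end of a list.
   Every elementary operation costs one unit of time. *)
Inductive binop := OpAdd | OpSub | OpMul | OpDiv | OpMod | OpEq | OpLt.

Inductive expr :=
  | Const of nat
  | InputLength
  | SAEntry of expr
  | LCPEntry of expr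
  | LetterEq of expr & expr (* w[e1] = w[e2] *)
  | LetterLt of expr & expr (* w[e1] < w[e2] *)
  | ReadMem of nat & expr
  | Binop of binop & expr & expr.

Inductive cmd :=
  | Skip
  | WriteMem of nat & expr & expr (* array name, index, value *)
  | Seq of cmd & cmd
  | If of expr & cmd & cmd
  | While of expr & cmd
  | PushFront of expr & expr & expr (* position, first and second component *)
  | PushBack of expr & expr & expr.

Record input (d : Order.disp_t) (A : orderType d) := Input {
  in_str : seq A;
  in_SA  : seq nat;
  in_LCP : seq nat }.

(* Words are the naturals below 2 ^ word_size; array a has
   [nth 0 layout a] cells, indexed from 0. *)
Record limits := Limits {
  word_size : nat;
  layout    : seq nat }.

Record state := State {
  memory : nat -> nat -> nat;
  output : seq (seq (nat * nat)) }.

Definition in_layout (L : limits) (a i : nat) : bool := i < nth 0 (layout L) a.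

Definition word (L : limits) (v : nat) : option nat :=
  if v < 2 ^ word_size L then Some v else None.

Definition eval_binop (o : binop) (x y : nat) : nat :=
  match o with
  | OpAdd => x + y
  | OpSub => x - y
  | OpMul => x * y
  | OpDiv => x %/ y
  | OpMod => x %% y
  | OpEq => (x == y)
  | OpLt => (x < y)
  end.

Definition read_entry (L : limits) (s : seq nat) (i : nat) : option nat :=
  if 1 <= i <= size s then word L (entry 0 s i) else None.

Definition compare_letters (A : eqType) (L : limits) (r : rel A) (w : seq A)
    (i j : nat) : option nat :=
  match ohead (suffix_at w i), ohead (suffix_at w j) with
  | Some x, Some y =>
      if (0 < i) && (0 < j) then word L (r x y) else None
  | _, _ => None
  end.

(* None on an access out of bounds or on a value that does not fit in a word. *)
Fixpoint eval (d : Order.disp_t) (A : orderType d) (L : limits)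
    (I : input A) (m : nat -> nat -> nat) (e : expr) : option nat :=
  match e with
  | Const k => word L k
  | InputLength => word L (size (in_str I))
  | SAEntry e1 => obind (read_entry L (in_SA I)) (eval L I m e1)
  | LCPEntry e1 => obind (read_entry L (in_LCP I)) (eval L I m e1)
  | LetterEq e1 e2 =>
      obind (fun i => obind (fun j =>
        compare_letters L (fun x y : A => x == y) (in_str I) i j)
          (eval L I m e2)) (eval L I m e1)
  | LetterLt e1 e2 =>
      obind (fun i => obind (fun j =>
        compare_letters L (fun x y : A => (x < y)%O) (in_str I) i j)
          (eval L I m e2)) (eval L I m e1)
  | ReadMem a e1 =>
      obind (fun i => if in_layout L a i then Some (m a i) else None)
        (eval L I m e1)
  | Binop o e1 e2 =>
      obind (fun x => obind (fun y => word L (eval_binop o x y))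
        (eval L I m e2)) (eval L I m e1)
  end.

Fixpoint cost (e : expr) : nat :=
  match e with
  | Const _ | InputLength => 1
  | SAEntry e1 | LCPEntry e1 | ReadMem _ e1 => (cost e1).+1
  | LetterEq e1 e2 | LetterLt e1 e2 | Binop _ e1 e2 => (cost e1 + cost e2).+1
  end.

Definition update (m : nat -> nat -> nat) (a i v : nat) : nat -> nat -> nat :=
  fun a' i' => if (a' == a) && (i' == i) then v else m a' i'.

Definition set_entry (T : Type) (x0 : T) (s : seq T) (i : nat) (v : T) : seq T :=
  set_nth x0 s i.-1 v.

(* [exec L I c s t s']: on input I, the command c leads from the state s to
   the state s' in time t without ever exceeding the limits L. *)
Inductive exec (d : Order.disp_t) (A : orderType d) (L : limits)
    (I : input A) : cmd -> state -> nat -> state -> Prop :=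
  | ExecSkip s : exec L I Skip s 1 s
  | ExecWriteMem a e1 e2 s i v :
      eval L I (memory s) e1 = Some i -> eval L I (memory s) e2 = Some v ->
      in_layout L a i ->
      exec L I (WriteMem a e1 e2) s (cost e1 + cost e2).+1
        (State (update (memory s) a i v) (output s))
  | ExecSeq c1 c2 s1 s2 s3 t1 t2 :
      exec L I c1 s1 t1 s2 -> exec L I c2 s2 t2 s3 ->
      exec L I (Seq c1 c2) s1 (t1 + t2) s3
  | ExecIf e c1 c2 s s' v t :
      eval L I (memory s) e = Some v ->
      exec L I (if v != 0 then c1 else c2) s t s' ->
      exec L I (If e c1 c2) s (cost e + t).+1 s'
  | ExecWhileEnd e c s :
      eval L I (memory s) e = Some 0 ->
      exec L I (While e c) s (cost e).+1 s
  | ExecWhileStep e c s1 s2 s3 v t1 t2 :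
      eval L I (memory s1) e = Some v -> v != 0 ->
      exec L I c s1 t1 s2 -> exec L I (While e c) s2 t2 s3 ->
      exec L I (While e c) s1 (cost e + t1 + t2).+1 s3
  | ExecPushFront e e1 e2 s i x y :
      eval L I (memory s) e = Some i -> eval L I (memory s) e1 = Some x ->
      eval L I (memory s) e2 = Some y -> 1 <= i <= size (in_str I) ->
      exec L I (PushFront e e1 e2) s (cost e + cost e1 + cost e2).+1
        (State (memory s)
           (set_entry [::] (output s) i ((x, y) :: entry [::] (output s) i)))
  | ExecPushBack e e1 e2 s i x y :
      eval L I (memory s) e = Some i -> eval L I (memory s) e1 = Some x ->
      eval L I (memory s) e2 = Some y -> 1 <= i <= size (in_str I) ->
      exec L I (PushBack e e1 e2) s (cost e + cost e1 + cost e2).+1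
        (State (memory s)
           (set_entry [::] (output s) i (rcons (entry [::] (output s) i) (x, y)))).

Definition initial_state (n : nat) : state :=
  State (fun _ _ => 0) (nseq n [::]).

(* P halts on I with output M, in time at most T, using at most S cells of
   working memory and words of b bits. *)
Definition computes_within (d : Order.disp_t) (A : orderType d) (P : cmd)
    (I : input A) (M : seq (seq (nat * nat))) (T S b : nat) : Prop :=
  exists (lay : seq nat) (t : nat) (s : state),
    [/\ sumn lay <= S, t <= T, output s = M &
        exec (Limits b lay) I P (initial_state (size (in_str I))) t s].

Definition bigO (f g : nat -> nat) : Prop :=
  exists c N : nat, forall n, N <= n -> f n <= c * g n.

(* Main.v *)
Require Import Defs.
From HB Require Import structures.
From mathcomp Require Import all_boot all_order.
From mathcomp Require Import zify.
Set Implicit Arguments.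
Unset Strict Implicit.
Unset Printing Implicit Defensive.

(* Let lcp(i, k) be the length of the longest common prefix of the suffixes at
   i and k. A factor starting at i is closed iff it ends at k + m - 1, where
   k > i is the next occurrence of the prefix of length m; it can be extended
   to the right unless m = lcp(i, k). So the entry of i consists of the pairs
   (k + lcp(i, k) - i, lcp(i, k)) where k is a record: lcp(i, k') < lcp(i, k)
   for all i < k' < k.

   The records are found by refining a partition of the suffix array into
   intervals, such that the records of i outside of the interval of i are
   already output. In each round every interval is cut around its middle rank,
   the pivot, into the runs of ranks that lie on the same side of the pivot and
   have the same lcp with it. For ranks of different runs, with lcps h and h'
   to the pivot, the mutual lcp is min(h, h'). Hence a stack of strictly
   increasing keys, in a scan of the positions from right to left, yields all
   the records between different runs in linear time, and as the runs are at
   most half as long as the interval, O(log n) rounds suffice. *)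

(** * Closed factors and records *)

Section CommonPrefix.
Variable A : eqType.
Implicit Types s t u y : seq A.

Lemma common_prefix_lengthC s t :
  common_prefix_length s t = common_prefix_length t s.
Proof. by elim: s t => [|x s IH] [|y t] //=; rewrite eq_sym IH. Qed.

Lemma leq_common_prefix_length m s t :
  (m <= common_prefix_length s t) = (m <= size s) && prefix (take m s) t.
Proof.
elim: s t m => [|x s IH] [|y t] [|m] //=; rewrite ?ltn0 ?andbF //.
case: eqVneq => [_|_]; rewrite /= ?andbF //; exact: IH.
Qed.

Lemma common_prefix_length_size s t : common_prefix_length s t <= size t.
Proof. by elim: s t => [|x s IH] [|y t] //=; case: ifP => // _; exact: IH. Qed.

End CommonPrefix.

(** If the outer strings start with the same letter, antisymmetry forces it on the middle one and
    the tails satisfy the same hypotheses. Otherwise an inner pair differs at once and both sides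
    vanish. *)
Lemma common_prefix_length_lex (d : Order.disp_t) (A : orderType d)
    (s t u : seq A) :
  lex_lt s t -> lex_lt t u ->
  common_prefix_length s u =
  minn (common_prefix_length s t) (common_prefix_length t u).
Proof.
rewrite /lex_lt; elim: s t u => [|x s IH] [|y t] [|z u] //=; rewrite ?min0n //.
rewrite !Order.SeqLexiOrder.ltxi_cons.
move=> /andP[xy /implyP st] /andP[yz /implyP tu].
case: (eqVneq x z) => [xz|xz].
  have yx : (y <= x)%O by rewrite xz.
  have zy : (z <= y)%O by rewrite -xz.
  have exy : x = y by apply: Order.POrderTheory.le_anti; rewrite xy yx.
  by rewrite -xz -exy !eqxx (IH t u (st yx) (tu zy)) minnSS.
case: (eqVneq x y) => [exy|]; last by rewrite min0n.
by rewrite -exy (negbTE xz) minn0.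
Qed.

Section Closed.
Variable A : eqType.
Implicit Types y : seq A.

(** The Z-function of [y]. *)
Definition shift_lcp y s := common_prefix_length y (drop s y).

(* y[1..l] is closed with longest border of length l - s; the empty border of a
   single letter is covered by s = l = 1. *)
Definition closed_shift y l s :=
  [/\ 0 < s <= l, l - s <= shift_lcp y s &
      forall s', 0 < s' < s -> shift_lcp y s' < l - s].

Lemma shift_lcp_size y s : shift_lcp y s <= size y - s.
Proof.
by apply: leq_trans (common_prefix_length_size _ _) _; rewrite size_drop.
Qed.

Lemma prefix_take_drop y m s l : l <= size y -> m <= size y -> 0 < m ->
  prefix (take m y) (drop s (take l y)) = (s + m <= l) && (m <= shift_lcp y s).
Proof.
move=> ly my m0; rewrite /shift_lcp leq_common_prefix_length my /=.
case: (leqP (s + m) l) => [sml|lsm] /=; last first.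
  apply/negP => /size_prefix; rewrite size_takel // size_drop size_takel //.
  by move=> ?; lia.
rewrite !prefixE size_takel // take_drop take_drop.
by rewrite take_takel // addnC.
Qed.

Lemma borderE y l u : l <= size y ->
  border u (take l y) =
  [&& 0 < size u < l, u == take (size u) y & size u <= shift_lcp y (l - size u)].
Proof.
move=> ly; rewrite /border size_takel //.
case: u => [|a u] //=.
set v := a :: u; have v0 : 0 < size v by [].
change (size u).+1 with (size v).
case: (ltnP (size v) l) => //= vl.
have -> : prefix v (take l y) = (v == take (size v) y).
  by rewrite prefixE take_takel 1?eq_sym // ltnW.
case: eqP => //= e.
rewrite suffixE size_takel // eq_sym.
have <- : prefix v (drop (l - size v) (take l y)) =
          (v == drop (l - size v) (take l y)).
  rewrite prefixE eq_sym take_oversize // size_drop size_takel //.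
  by lia.
rewrite {1}e prefix_take_drop //; last by lia.
by rewrite subnK ?leqnn // ltnW.
Qed.

(** The shift is the distance between the two occurrences of the border, which thus has length
    [l - s]; an inner occurrence is a smaller shift with at least as long a match. *)
Lemma closed_stringP y l : 0 < l <= size y ->
  closed_string (take l y) <-> exists s, closed_shift y l s.
Proof.
move=> /andP[l0 ly]; rewrite /closed_string size_takel //; split.
  case=> [->|[l2 [u []]]].
    by exists 1; split=> //; lia.
  rewrite borderE // => /and3P[/andP[u0 ul] /eqP eu cu] occ.
  exists (l - size u); split=> //; first by lia.
    by rewrite subKn // ltnW.
  move=> s' s'P; rewrite subKn; last by lia.
  rewrite ltnNge; apply/negP => us'.
  have := occ s'.+1; rewrite /occurs_at /suffix_at /= eu.
  rewrite prefix_take_drop //; last by lia.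
  rewrite -eu us' andbT => H.
  by case: H; lia.
case=> s [/andP[s0 sl] cs hs].
case: (ltngtP l 1) => [|l1|->]; [by lia| |by left].
right; split=> //.
(* For [s = l > 1], the shift 1 would need a match of length below 0. *)
have sl' : s < l.
  rewrite ltn_neqAle sl andbT; apply/eqP => e; subst s.
  by have := hs 1; lia.
exists (take (l - s) y).
have szu : size (take (l - s) y) = l - s by rewrite size_takel //; lia.
rewrite borderE // szu eqxx subKn // cs.
split; first by rewrite /=; lia.
move=> [|k] //; rewrite /occurs_at /suffix_at /=.
rewrite prefix_take_drop //; [|by lia|by lia].
move=> /andP[kl ck].
case: k kl ck => [|k] kl ck; first by left.
right; apply/eqP; rewrite eqn_leq; apply/andP; split; first by lia.
rewrite leqNgt; apply/negP => lt; have := hs k.+1; lia.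
Qed.

(** A longer border would be a match of its length at a smaller shift. *)
Lemma longest_border_lengthP y l s b : l <= size y -> closed_shift y l s ->
  longest_border_length (take l y) b <-> b = l - s.
Proof.
move=> ly [/andP[s0 sl] cs hs]; rewrite /longest_border_length size_takel //.
case: (ltngtP l 1) => [|l1|l1]; [by lia| |]; last first.
  by split=> [[[]|[]]|]; [lia|lia|left; lia].
have sl' : s < l.
  rewrite ltn_neqAle sl andbT; apply/eqP => e; subst s.
  by have := hs 1; lia.
have szu : size (take (l - s) y) = l - s by rewrite size_takel //; lia.
have bu : border (take (l - s) y) (take l y).
  by rewrite borderE // szu eqxx subKn // cs /=; lia.
have mx v : border v (take l y) -> size v <= l - s.
  rewrite borderE // => /and3P[/andP[v0 vl] _ cv].
  by rewrite leqNgt; apply/negP => lt; have := hs (l - size v); lia.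
split.
  case=> [[]|[_ [u [bdu <- umx]]]]; first by lia.
  by apply/eqP; rewrite eqn_leq mx //= -szu umx.
by move=> ->; right; split=> //; exists (take (l - s) y).
Qed.

End Closed.

Definition lcp_at (A : eqType) (w : seq A) i k :=
  common_prefix_length (suffix_at w i) (suffix_at w k).

(* Among all later positions, k is the first one that agrees with i on its
   first [lc i k] letters; n + 1 stands for the empty suffix. *)
Definition next_record n (lc : nat -> nat -> nat) i k :=
  i < k <= n.+1 /\ forall k', i < k' < k -> lc i k' < lc i k.

Section Spec.
Variables (A : eqType) (w : seq A).

Lemma lcp_at_shift i k : 0 < i < k ->
  lcp_at w i k = shift_lcp (suffix_at w i) (k - i).
Proof.
move=> ik; rewrite /lcp_at /shift_lcp /suffix_at drop_drop.
by congr (common_prefix_length _ (drop _ _)); lia.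
Qed.

Lemma lcp_at_bound i k : 0 < k -> lcp_at w i k <= (size w).+1 - k.
Proof.
move=> k0; apply: leq_trans (common_prefix_length_size _ _) _.
by rewrite size_drop; lia.
Qed.

Lemma lcp_atC i k : lcp_at w i k = lcp_at w k i.
Proof. exact: common_prefix_lengthC. Qed.

(** The later of the two positions is at least 2, so its suffix is shorter than [w]. Hence n can act
    as infinity among the lcps. *)
Lemma lcp_at_lt i k : 0 < i -> 0 < k -> i != k -> i <= size w -> k <= size w ->
  lcp_at w i k < size w.
Proof.
move=> i0 k0 ik iN kN.
by have := @lcp_at_bound i k k0; have := @lcp_at_bound k i i0; rewrite lcp_atC; lia.
Qed.

Lemma lcp_at_end i : lcp_at w i (size w).+1 = 0.
Proof. by have := @lcp_at_bound i (size w).+1; lia. Qed.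

(** The shift is [k - i], and maximality forces the match at this shift to its full length. The
    position n + 1 is a record only for i = n, where it yields the pair (1, 0). *)
Lemma MRC_pairP i l b : 1 <= i <= size w ->
  [/\ 1 <= l, maximal_right_closed w i (i + l).-1 &
      longest_border_length (substr w i (i + l).-1) b] <->
  exists k, [/\ next_record (size w) (lcp_at w) i k,
                l = k + lcp_at w i k - i & b = lcp_at w i k].
Proof.
move=> iw; set y := suffix_at w i.
have sy : size y = (size w).+1 - i by rewrite size_drop; lia.
have subE l' : substr w i (i + l').-1 = take l' y.
  rewrite /substr; congr (take _ _); lia.
have subES : 0 < l -> substr w i (i + l).-1.+1 = take l.+1 y.
  by move=> l0; rewrite /substr; congr (take _ _); lia.
split.
  case=> l0; case=> [_ jw]; rewrite subE subES // => cl mx lb.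
  have ly : 0 < l <= size y by lia.
  have [s cs] := (closed_stringP ly).1 cl.
  have bE : b = l - s by apply/(longest_border_lengthP _ _ cs) => //; lia.
  have [sl css hs] := cs.
  (* A longer match would make the extension by one letter closed with the same shift. *)
  have cE : shift_lcp y s = l - s.
    apply/eqP; rewrite eqn_leq css andbT leqNgt; apply/negP => lt.
    have bd := shift_lcp_size y s.
    case: mx => [|mx]; first by lia.
    apply: mx; apply/closed_stringP; first by lia.
    by exists s; split; [lia|lia|move=> s' /hs; lia].
  have lcE : lcp_at w i (i + s) = l - s.
    by rewrite lcp_at_shift ?addKn //; lia.
  exists (i + s); split; [|lia|lia].
  split; first by lia.
  move=> k' k'P; rewrite lcE lcp_at_shift; last by lia.
  by apply: hs; lia.
case=> k [[kP hk] -> ->]; clear l b subES.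
have lcE : lcp_at w i k = shift_lcp y (k - i) by rewrite lcp_at_shift //; lia.
have bd := shift_lcp_size y (k - i).
rewrite lcE in hk *.
set c := shift_lcp y (k - i) in lcE hk bd *.
have cs : closed_shift y (k + c - i) (k - i).
  split; [lia|rewrite -/c; lia|move=> s' s'P].
  have := hk (i + s'); rewrite lcp_at_shift ?addKn //; last by lia.
  by rewrite -/y; lia.
set l := k + c - i in cs *.
have ly : 0 < l <= size y by rewrite /l; lia.
have e : (i + l).-1.+1 = i + l by lia.
split; first by lia.
  split; [lia|lia| |].
    by rewrite subE; apply/closed_stringP => //; exists (k - i).
  case: (leqP (size w).+1 (i + l)) => lw; [left; lia|right].
  rewrite /substr e.
  have -> : (i + l).+1 - i = l.+1 by lia.
  rewrite -/(suffix_at w i) -/y => /closed_stringP.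
  case; first by lia.
  move=> s2 [s2l c2 h2].
  have [_ _ hs] := cs.
  (* A smaller shift for the extension contradicts the record [k], a larger one passes over the
     match at [k - i], and the same one needs a match longer than [c]. *)
  case: (ltngtP s2 (k - i)) => cmp.
  - by have := hs s2; lia.
  - have := h2 (k - i); rewrite -/c /l; lia.
  - by move: c2; rewrite cmp -/c /l; lia.
rewrite subE; apply/(longest_border_lengthP _ _ cs); first by lia.
by rewrite /l; lia.
Qed.

End Spec.

(** * Verification of commands *)

Section Hoare.
Variables (d : Order.disp_t) (A : orderType d) (L : limits) (I : input A).
Implicit Types (e : expr) (c : cmd) (s : state) (Q : state -> Prop).

(** A total evaluator without bound checks, to be trusted only on [safe] expressions; letter
    comparisons get a dummy value. *)
Fixpoint denote (m : nat -> nat -> nat) e : nat :=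
  match e with
  | Const k => k
  | InputLength => size (in_str I)
  | SAEntry e1 => entry 0 (in_SA I) (denote m e1)
  | LCPEntry e1 => entry 0 (in_LCP I) (denote m e1)
  | LetterEq _ _ | LetterLt _ _ => 0
  | ReadMem a e1 => m a (denote m e1)
  | Binop o e1 e2 => eval_binop o (denote m e1) (denote m e2)
  end.

Definition fits v := v < 2 ^ word_size L.

(* Comparisons of letters are rejected: the program below makes none. *)
Fixpoint safe (m : nat -> nat -> nat) e : Prop :=
  match e with
  | Const k => fits k
  | InputLength => fits (size (in_str I))
  | SAEntry e1 => [/\ safe m e1, 1 <= denote m e1 <= size (in_SA I) &
                      fits (entry 0 (in_SA I) (denote m e1))]
  | LCPEntry e1 => [/\ safe m e1, 1 <= denote m e1 <= size (in_LCP I) &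
                       fits (entry 0 (in_LCP I) (denote m e1))]
  | LetterEq _ _ | LetterLt _ _ => False
  | ReadMem a e1 => safe m e1 /\ in_layout L a (denote m e1)
  | Binop o e1 e2 => [/\ safe m e1, safe m e2 &
                         fits (eval_binop o (denote m e1) (denote m e2))]
  end.

Lemma eval_safe m e : safe m e -> eval L I m e = Some (denote m e).
Proof.
elim: e => [k||e IH|e IH|//|//|a e IH|o e1 IH1 e2 IH2] /=.
- by rewrite /word /fits => ->.
- by rewrite /word /fits => ->.
- by case=> /IH -> H1; rewrite /= /read_entry H1 /word /fits => ->.
- by case=> /IH -> H1; rewrite /= /read_entry H1 /word /fits => ->.
- by case=> /IH -> /= ->.
- by case=> /IH1 -> /IH2 ->; rewrite /= /word /fits => ->.
Qed.

Definition runs c s B Q :=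
  exists t s', [/\ exec L I c s t s', t <= B & Q s'].

(** For loop-free code only; the value at a loop is a dummy, as [wp] is false there. *)
Fixpoint max_time c : nat :=
  match c with
  | Skip => 1
  | WriteMem _ e1 e2 => (cost e1 + cost e2).+1
  | Seq c1 c2 => max_time c1 + max_time c2
  | If e c1 c2 => (cost e + maxn (max_time c1) (max_time c2)).+1
  | While _ _ => 0
  | PushFront e e1 e2 | PushBack e e1 e2 => (cost e + cost e1 + cost e2).+1
  end.

Definition push_front (o : seq (seq (nat * nat))) i p :=
  set_entry [::] o i (p :: entry [::] o i).

Lemma size_push_front o i p : 0 < i <= size o -> size (push_front o i p) = size o.
Proof. by move=> h; rewrite /push_front size_set_nth; lia. Qed.

Lemma entry_push_front o i x p : 0 < i -> 0 < x ->
  entry [::] (push_front o i p) x =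
  if x == i then p :: entry [::] o i else entry [::] o x.
Proof.
move=> i0 x0; rewrite /push_front /set_entry /entry nth_set_nth /=.
by have -> : (x.-1 == i.-1) = (x == i) by lia.
Qed.

(** Loops are left to [runs_while], where an invariant and a time bound are supplied. *)
Fixpoint wp c Q s : Prop :=
  match c with
  | Skip => Q s
  | WriteMem a e1 e2 =>
      [/\ safe (memory s) e1, safe (memory s) e2,
          in_layout L a (denote (memory s) e1) &
          Q (State (update (memory s) a (denote (memory s) e1)
                      (denote (memory s) e2)) (output s))]
  | Seq c1 c2 => wp c1 (wp c2 Q) s
  | If e c1 c2 =>
      safe (memory s) e /\
      (if denote (memory s) e != 0 then wp c1 Q s else wp c2 Q s)
  | PushFront e e1 e2 =>
      [/\ safe (memory s) e /\ 1 <= denote (memory s) e <= size (in_str I),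
          safe (memory s) e1, safe (memory s) e2 &
          Q (State (memory s) (push_front (output s) (denote (memory s) e)
               (denote (memory s) e1, denote (memory s) e2)))]
  | While _ _ | PushBack _ _ _ => False
  end.

Lemma wp_seq c1 c2 Q s : wp c1 (wp c2 Q) s -> wp (Seq c1 c2) Q s.
Proof. by []. Qed.

Lemma wp_if e c1 c2 Q s : safe (memory s) e ->
  (denote (memory s) e <> 0 -> wp c1 Q s) ->
  (denote (memory s) e = 0 -> wp c2 Q s) -> wp (If e c1 c2) Q s.
Proof. by move=> sf h1 h2; split=> //; case: eqP => /= [/h2|/h1]. Qed.

Lemma runs_wp c Q s : wp c Q s -> runs c s (max_time c) Q.
Proof.
elim: c Q s => [|a e1 e2|c1 IH1 c2 IH2|e c1 IH1 c2 IH2|//|e e1 e2|//] Q s /=.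
- by move=> q; exists 1, s; split=> //; constructor.
- case=> /eval_safe h1 /eval_safe h2 ly q.
  by eexists _, _; split; [apply: ExecWriteMem h1 h2 ly| |].
- move=> /IH1 [t1 [s1 [r1 b1]]] /IH2 [t2 [s2 [r2 b2 q]]].
  by exists (t1 + t2), s2; split=> //; [apply: ExecSeq r1 r2|lia].
- case=> /eval_safe h H.
  have [t [s' [r b q]]] : runs (if denote (memory s) e != 0 then c1 else c2) s
      (maxn (max_time c1) (max_time c2)) Q.
    by move: H; case: ifP => _; [move/IH1|move/IH2];
       case=> t [s' [r b q]]; exists t, s'; split=> //; lia.
  by exists (cost e + t).+1, s'; split=> //; [apply: ExecIf h r|lia].
- case=> [[/eval_safe h hi] /eval_safe h1 /eval_safe h2 q].
  by eexists _, _; split; [apply: ExecPushFront h h1 h2 hi| |].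
Qed.

Lemma runs_weaken c s B B' Q Q' :
  runs c s B Q -> B <= B' -> (forall s', Q s' -> Q' s') -> runs c s B' Q'.
Proof.
by case=> t [s' [r b q]] bb qq; exists t, s'; split; [|lia|exact: qq].
Qed.

Lemma runs_seq c1 c2 s B1 B2 Q1 Q :
  runs c1 s B1 Q1 -> (forall s1, Q1 s1 -> runs c2 s1 B2 Q) ->
  runs (Seq c1 c2) s (B1 + B2) Q.
Proof.
case=> t1 [s1 [r1 b1 q1]] /(_ _ q1) [t2 [s2 [r2 b2 q]]].
by exists (t1 + t2), s2; split=> //; [apply: ExecSeq r1 r2|lia].
Qed.

(* [Inv j s] with j bounding what is left to do, and [T j] the time left. *)
Lemma runs_while e c (Inv : nat -> state -> Prop) (T : nat -> nat) Q j s :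
  (forall j s, Inv j s -> safe (memory s) e /\
     if denote (memory s) e == 0 then Q s /\ cost e < T j else
     exists B, runs c s B (fun s' => exists j',
       [/\ Inv j' s', j' < j & B + (cost e).+1 + T j' <= T j])) ->
  Inv j s -> runs (While e c) s (T j) Q.
Proof.
move=> step; elim/ltn_ind: j s => j IH s iv.
have [/eval_safe h] := step _ _ iv.
case: eqP h => [-> h [q ct]|/eqP nz h [B [t [s' [r b [j' [iv' lt tm]]]]]]].
  by exists (cost e).+1, s; split=> //; constructor.
have [t2 [s2 [r2 b2 q]]] := IH _ lt _ iv'.
exists (cost e + t + t2).+1, s2; split=> //; last by lia.
exact: ExecWhileStep h nz r r2.
Qed.

(** The final failing test is charged as one more iteration, hence [j.+1]. *)
Lemma runs_for e c (Inv : nat -> state -> Prop) B Q j s :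
  (forall s, Inv 0 s ->
     [/\ safe (memory s) e, denote (memory s) e = 0 & Q s]) ->
  (forall j s, Inv j.+1 s ->
     [/\ safe (memory s) e, denote (memory s) e != 0 & runs c s B (Inv j)]) ->
  Inv j s -> runs (While e c) s ((B + (cost e).+1) * j.+1) Q.
Proof.
move=> fin step iv.
apply: (runs_while (Inv := Inv) (T := fun j => (B + (cost e).+1) * j.+1)) iv.
move=> {s} [|k] s iv; first by have [? -> ?] := fin _ iv; split=> //=; split=> //; lia.
have [? nz r] := step _ _ iv; split=> //; rewrite (negbTE nz).
exists B; apply: runs_weaken r _ _ => // s' iv'.
by exists k; split=> //; rewrite [in leqRHS]mulnS; lia.
Qed.

End Hoare.

(** * Refining the suffix array *)

(* What has been output for position i, given the list [o], when exactly the
   records satisfying P have been treated. *)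
Section Emission.
Variables (n : nat) (lc : nat -> nat -> nat) (i : nat).
Implicit Types P : nat -> Prop.

Local Notation record := (next_record n lc i).

Definition emitted P (o : seq (nat * nat)) (last : nat) :=
  [/\ sorted (fun p q : nat * nat => q.1 < p.1) o,
      forall l b, (l, b) \in o <->
        exists k, [/\ record k, P k, l = k + lc i k - i & b = lc i k],
      forall k, record k -> P k -> lc i k < last &
      last = 0 \/ exists k, [/\ record k, P k & last = (lc i k).+1]].

Lemma emitted_ext P P' o last :
  (forall k, record k -> P k <-> P' k) -> emitted P o last -> emitted P' o last.
Proof.
move=> PP [so mo bo lo]; split=> //.
- move=> l b; split=> [/mo|] [k [rk pk -> ->]]; last first.
    by apply/mo; exists k; split=> //; apply/PP.
  by exists k; split=> //; apply/PP.
- by move=> k rk /(PP _ rk); exact: bo.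
- by case: lo => [->|[k [rk pk ->]]]; [left|right; exists k; split=> //; apply/PP].
Qed.

(** If some earlier position matches at least as far, descend to it and repeat. *)
Lemma earlier_record k : i < k <= n.+1 ->
  record k \/ exists k', [/\ record k', k' < k & lc i k <= lc i k'].
Proof.
elim/ltn_ind: k => k IH ik.
case: (boolP (has (fun k' => lc i k <= lc i k') (iota i.+1 (k - i.+1)))).
  case/hasP => k'; rewrite mem_iota => k'P kk'; right.
  have [||r|[k2 [r lt le]]] := IH k'; [by lia|by lia|exists k'|exists k2].
    by split=> //; lia.
  by split=> //; lia.
move/hasPn => H; left; split=> // k' k'P.
by have := H k'; rewrite mem_iota -ltnNge => -> //; lia.
Qed.

(** Comparing with [last] decides whether [k] is a record: at or above it, no earlier record reaches
    [lc i k], so [earlier_record] applies. All treated records then lie before [k], so insertion at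
    the front keeps the list sorted. *)
Lemma emit_step P o last k :
  emitted P o last -> i < k <= n.+1 -> ~ P k ->
  (forall k', record k' -> k' < k -> P k') ->
  (forall k', record k' -> P k' -> k < k' -> lc i k' <= lc i k) ->
  emitted (fun k' => P k' \/ k' = k)
    (if lc i k < last then o else (k + lc i k - i, lc i k) :: o)
    (if lc i k < last then last else (lc i k).+1).
Proof.
move=> em ik nP h1 h2; have [so mo bo lo] := em.
case: ltnP => cmp.
  apply: emitted_ext em => k' rk'; split=> [|[//|e]]; first by left.
  (* A treated record [k2] matches at least as far as [k]. Before [k], it prevents [k] from being a
     record; after [k], the last hypothesis and its own record property conflict. *)
  case: lo => [lE|[k2 [r2 p2 lE]]]; first by rewrite lE in cmp.
  subst k'; exfalso.
  case: (ltngtP k2 k) => c2.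
  - by have [_ /(_ k2)] := rk'; have [] := r2; lia.
  - by have [_ /(_ k)] := r2; have := h2 _ r2 p2 c2; lia.
  - by subst k2.
have rk : record k.
  case: (earlier_record ik) => // -[k' [r' lt le]].
  by have := bo _ r' (h1 _ r' lt); lia.
split.
- rewrite /= path_sortedE; last by move=> p q r; lia.
  rewrite so andbT; apply/allP => -[l b] /mo [k' [r' p' -> _]] /=.
  have b' := bo _ r' p'; have [k'P k'm] := r'.
  case: (ltngtP k' k) => c; [lia| |by subst k'].
  by have := k'm k; lia.
- move=> l b; rewrite inE; split.
    case/orP => [/eqP[-> ->]|/mo [k' [r' p' -> ->]]].
      by exists k; split=> //; right.
    by exists k'; split=> //; left.
  case=> k' [r' [p'|->] -> ->]; last by rewrite eqxx.
  by apply/orP; right; apply/mo; exists k'.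
- by move=> k' r' [p'|-> //]; have := bo _ r' p'; lia.
- by right; exists k; split=> //; right.
Qed.

End Emission.

(** * Common prefixes with a pivot rank, and partitions of the ranks *)

Section Groups.
Variables (n : nat) (lc : nat -> nat -> nat) (SA rk : nat -> nat).
Hypothesis lcC : forall i k, lc i k = lc k i.
Hypothesis lc_lt : forall i k, 0 < i -> 0 < k -> i != k -> i <= n -> k <= n ->
  lc i k < n.
Hypothesis lc_end : forall i, lc i n.+1 = 0.
Hypothesis lc_mid : forall p q r, 0 < p -> p < q -> q < r -> r <= n ->
  lc (SA p) (SA r) = minn (lc (SA p) (SA q)) (lc (SA q) (SA r)).
Hypothesis rkP : forall x, 0 < x <= n -> 0 < rk x <= n /\ SA (rk x) = x.
Hypothesis SAP : forall r, 0 < r <= n -> 0 < SA r <= n /\ rk (SA r) = r.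

Definition dist p q := lc (SA p) (SA q).

(** The value n at the pivot stands for infinity, since all lcps of distinct ranks are smaller. *)
Definition pivot_lcp q c := if q == c then n else dist q c.

(* The parity records the side of the pivot, so that ranks with equal keys are
   consecutive. *)
Definition pivot_key c q :=
  if q <= c then 2 * pivot_lcp q c else (2 * pivot_lcp q c).+1.

Lemma distC p q : dist p q = dist q p.
Proof. exact: lcC. Qed.

Lemma dist_lt p q : 0 < p <= n -> 0 < q <= n -> p != q -> dist p q < n.
Proof.
move=> hp hq ne; have [sp rp] := SAP hp; have [sq rq] := SAP hq.
apply: lc_lt; try lia.
by apply/eqP => e; move: ne; rewrite -rp -rq e eqxx.
Qed.

Lemma pivot_lcp_le q c : 0 < q <= n -> 0 < c <= n -> pivot_lcp q c <= n.
Proof.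
by rewrite /pivot_lcp => hq hc; case: eqVneq => // ne; have := dist_lt hq hc ne; lia.
Qed.

Lemma pivot_lcp_left p q c : 0 < p -> p < q -> q <= c -> c <= n ->
  pivot_lcp p c = minn (dist p q) (pivot_lcp q c).
Proof.
move=> p0 pq qc cn; rewrite /pivot_lcp; have -> : (p == c) = false by lia.
case: eqVneq => [->|ne]; last by apply: lc_mid => //; lia.
by have := @dist_lt p c; lia.
Qed.

Lemma pivot_lcp_right p q c : 0 < c -> c <= q -> q < p -> p <= n ->
  pivot_lcp p c = minn (dist p q) (pivot_lcp q c).
Proof.
move=> p0 pq qc cn; rewrite /pivot_lcp; have -> : (p == c) = false by lia.
case: eqVneq => [->|ne]; first by have := @dist_lt p c; lia.
by rewrite distC (distC p q) (distC q c) minnC; apply: lc_mid => //; lia.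
Qed.

Lemma pivot_lcp_across p q c : 0 < p -> p <= c -> c < q -> q <= n ->
  dist p q = minn (pivot_lcp p c) (pivot_lcp q c).
Proof.
move=> p0 pc cq qn; rewrite /pivot_lcp; have -> : (q == c) = false by lia.
rewrite (distC q c).
case: eqVneq => [->|ne]; last by apply: lc_mid => //; lia.
by have := @dist_lt c q; lia.
Qed.

(** Across the pivot the parities differ and the mutual lcp is the minimum. On one side the lcp with
    the pivot grows towards it, so unequal values make the smaller one the mutual lcp, while equal
    ones only bound it from below. Halving removes the parity. *)
Lemma pivot_key_dist c p q :
  0 < p <= n -> 0 < q <= n -> 0 < c <= n -> p != q ->
  if pivot_key c p == pivot_key c q then is_true (pivot_key c p %/ 2 <= dist p q)
  else dist p q = (minn (pivot_key c p) (pivot_key c q)) %/ 2.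
Proof.
wlog pq : p q / p < q.
  move=> W hp hq hc ne; case: (ltngtP p q) => c'; [exact: W| |lia].
  have := W _ _ c' hq hp hc; rewrite eq_sym minnC (distC q p) => /(_ ne).
  rewrite [pivot_key c q == _]eq_sym.
  by case: eqP => [->|].
move=> hp hq hc _; rewrite /pivot_key.
case: (leqP p c) => pc; case: (leqP q c) => qc; try lia.
- have := @pivot_lcp_left p q c; case: ifP; lia.
- have := @pivot_lcp_across p q c; case: ifP; lia.
- have := @pivot_lcp_right q p c; rewrite (distC q p); case: ifP; lia.
Qed.

(** Equal parities put both ends on one side, where the keys are monotone. *)
Lemma pivot_key_between c p q r :
  0 < p -> p <= q -> q <= r -> r <= n -> 0 < c <= n ->
  pivot_key c p = pivot_key c r -> pivot_key c q = pivot_key c p.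
Proof.
move=> p0 pq qr rn hc.
case: (eqVneq p q) => [-> //|npq]; case: (eqVneq q r) => [-> -> //|nqr].
rewrite /pivot_key.
case: (leqP p c) => pc; case: (leqP r c) => rc; try lia.
- have -> : q <= c by lia.
  have := @pivot_lcp_left p q c; have := @pivot_lcp_left q r c; lia.
- have -> : q <= c = false by lia.
  have := @pivot_lcp_right q p c; have := @pivot_lcp_right r q c; lia.
Qed.

(** The pivot is alone in its run, because no other rank attains n. *)
Lemma pivot_key_side c p q : 0 < p -> p < q -> q <= n -> 0 < c <= n ->
  pivot_key c p = pivot_key c q -> q < c \/ c < p.
Proof.
move=> p0 pq qn hc; rewrite /pivot_key.
case: (leqP p c) => pc; case: (leqP q c) => qc; try lia.
move=> e; left; rewrite ltn_neqAle qc andbT; apply/eqP => e2; subst q.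
by move: e; rewrite /pivot_lcp eqxx; have := @dist_lt p c; case: eqP; lia.
Qed.

(* A partition of the ranks 1..n into intervals; [lo r] is the first rank of
   the interval of r, and [hi r] the last. *)
Definition intervals (lo : nat -> nat) := forall r, 0 < r <= n ->
  0 < lo r <= r /\ forall q, lo r <= q <= r -> lo q = lo r.

Definition last_of (lo : nat -> nat) r h :=
  [/\ r <= h <= n, forall q, r <= q <= h -> lo q = lo r &
      forall q, h < q <= n -> lo q != lo r].

(** The intervals are clusters of the ultrametric given by the lcp. Thus records outside of an
    interval never have larger lcps than those inside, and can be output first. *)
Definition nested (lo : nat -> nat) := forall p q r,
  0 < p <= n -> 0 < q <= n -> 0 < r <= n -> p != q ->
  lo p = lo q -> lo r != lo p -> dist p r <= dist p q.

(** Being strict, the bound makes all intervals singletons as soon as [sz <= 1]. *)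
Definition small (lo : nat -> nat) sz := forall p q,
  0 < p -> p < q -> q <= n -> lo p = lo q -> q - p < sz.

Lemma intervals_between lo p q r : intervals lo ->
  0 < p -> p <= q -> q <= r -> r <= n -> lo p = lo r -> lo q = lo p.
Proof.
move=> il p0 pq qr rn e; have [|h1 h2] := il r; first by lia.
by have [|h3 _] := il p; [lia|]; rewrite h2; lia.
Qed.

(** The recurrence for a pass from right to left; the sentinel at n + 1 closes the last interval. *)
Lemma last_of_step lo r h h' : intervals lo -> 0 < r <= n ->
  lo n.+1 = n.+1 -> (r < n -> last_of lo r.+1 h') ->
  h = (if lo r.+1 == r.+1 then r else h') -> last_of lo r h.
Proof.
move=> il hr le hl ->; case: (ltngtP r n) => c; [|by lia|]; last first.
  by rewrite -c in le *; rewrite le eqxx; split=> [|q|q]; [lia|move=> ?; congr lo|]; lia.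
have [h1 h2 h3] := hl c; have [|h4 h5] := il r.+1; first by lia.
case: eqP => e.
  split=> [|q|q qP]; [lia|by move=> ?; congr lo; lia|].
  have [|h6 h7] := il q; first by lia.
  have [h8 _] := il r hr.
  by apply/eqP => e2; have := h7 r.+1; lia.
have er : lo r = lo r.+1 by apply: h5; lia.
split=> [|q qP|q qP]; [by lia| |by rewrite er h3].
case: (eqVneq q r) => [-> //|ne]; rewrite er; apply: h2; lia.
Qed.

(** * Cutting every interval into runs of equal keys *)

Section Refine.
Variables lo hi : nat -> nat.
Hypothesis lo_int : intervals lo.
Hypothesis lo_nested : nested lo.
Hypothesis hiP : forall r, 0 < r <= n -> last_of lo r (hi r).

Definition mid r := (lo r + hi r) %/ 2.
Definition rank_key r := pivot_key (mid r) r.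

Lemma hi_eq p q : 0 < p <= n -> 0 < q <= n -> lo p = lo q -> hi p = hi q.
Proof.
move=> hp hq e; have [h1 h2 h3] := hiP hp; have [k1 k2 k3] := hiP hq.
apply/eqP; case: (ltngtP (hi p) (hi q)) => // c.
  by have := h3 (hi q); rewrite k2 -?e ?eqxx; lia.
by have := k3 (hi p); rewrite h2 ?e ?eqxx; lia.
Qed.

(** So the last rank can name the interval, and serves as the index of its stack. *)
Lemma hi_lo p q : 0 < p <= n -> 0 < q <= n -> (hi p == hi q) = (lo p == lo q).
Proof.
move=> hp hq; apply/eqP/eqP => [e|]; last exact: hi_eq.
have [h1 h2 h3] := hiP hp; have [k1 k2 k3] := hiP hq.
by rewrite -(h2 (hi p)) -?(k2 (hi q)) ?e //; lia.
Qed.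

Lemma mid_eq p q : 0 < p <= n -> 0 < q <= n -> lo p = lo q -> mid p = mid q.
Proof. by move=> hp hq e; rewrite /mid e (hi_eq hp hq e). Qed.

Lemma mid_bound r : 0 < r <= n -> lo r <= mid r <= hi r /\ 0 < mid r <= n.
Proof.
move=> hr; have [h _ _] := hiP hr; have [k _] := lo_int hr; rewrite /mid; lia.
Qed.

Lemma key_dist p q : 0 < p <= n -> 0 < q <= n -> p != q -> lo p = lo q ->
  if rank_key p == rank_key q then is_true (rank_key p %/ 2 <= dist p q)
  else dist p q = (minn (rank_key p) (rank_key q)) %/ 2.
Proof.
move=> hp hq ne e; rewrite /rank_key -(mid_eq hp hq e).
by apply: pivot_key_dist => //; have [] := mid_bound hp.
Qed.

Lemma key_between p q r : 0 < p -> p <= q -> q <= r -> r <= n ->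
  lo p = lo r -> rank_key p = rank_key r -> rank_key q = rank_key p.
Proof.
move=> p0 pq qr rn e; rewrite /rank_key.
have eq := intervals_between lo_int p0 pq qr rn e.
have hp : 0 < p <= n by lia.
have hq : 0 < q <= n by lia.
have hr : 0 < r <= n by lia.
rewrite -(mid_eq hp hq (esym eq)) -(mid_eq hp hr e).
by apply: pivot_key_between => //; have [] := mid_bound hp.
Qed.

(** Only ranks up to [r] are involved, so a pass from left to right can establish this rank by rank
    while the rest of [LO] still holds the old partition. *)
Definition refines (lo1 : nat -> nat) r :=
  [/\ 0 < lo1 r <= r,
      forall q, lo1 r <= q <= r ->
        [/\ lo q = lo r, lo1 q = lo1 r & rank_key q = rank_key r] &
      lo1 r = r -> lo r = r \/ rank_key r.-1 <> rank_key r].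

Lemma refines_ext lo1 lo2 r : (forall q, q <= r -> lo1 q = lo2 q) ->
  refines lo1 r -> refines lo2 r.
Proof.
move=> e [h1 h2 h3]; split; rewrite -?e //.
by move=> q qP; rewrite -e; [apply: h2|lia].
Qed.

Lemma refines_step lo1 r : 0 < r <= n ->
  (forall q, 0 < q < r -> refines lo1 q) ->
  lo1 r = (if lo r == r then r else
           if rank_key r == rank_key r.-1 then lo1 r.-1 else r) ->
  refines lo1 r.
Proof.
move=> hr hq e.
have triv : lo1 r = r -> lo r = r \/ rank_key r.-1 <> rank_key r -> refines lo1 r.
  move=> er h; split=> //; rewrite er; first by lia.
  by move=> q qr; have -> : q = r by lia.
case: eqP e => [e1|ne1] e; first by apply: triv => //; left.
case: eqP e => [e2|ne2] e; last by apply: triv => //; right; apply/nesym.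
have [h1 h2] := lo_int hr.
have el : lo r.-1 = lo r by apply: h2; lia.
have [|k1 k2 _] := hq r.-1; first by lia.
split=> [|q qP|]; [lia| |lia].
case: (eqVneq q r) => [-> //|ne].
by rewrite e2 -el e; apply: k2; lia.
Qed.

Variable lo1 : nat -> nat.
Hypothesis lo1P : forall r, 0 < r <= n -> refines lo1 r.

(** The converse is the maximality of runs: if [p] lay before the start of the run of [q], then
    [key_between] would give the rank just before that start the same key. *)
Lemma refines_eq p q : 0 < p <= n -> 0 < q <= n ->
  lo1 p = lo1 q <-> lo p = lo q /\ rank_key p = rank_key q.
Proof.
wlog pq : p q / p <= q.
  move=> W hp hq; case: (leqP p q) => c; first exact: W.
  have {}W := W q p (ltnW c) hq hp.
  split=> [e|[e1 e2]]; first by have [-> ->] := W.1 (esym e).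
  exact/esym/(W.2 (conj (esym e1) (esym e2))).
move=> hp hq; have [h1 h2 _] := lo1P hq; have [k1 _ _] := lo1P hp.
split=> [e|[e1 e2]].
  by have [] := h2 p; [lia|move=> -> _ ->].
case: (leqP (lo1 q) p) => c; first by have [] := h2 p; lia.
have [|es1 es2 es3] := h2 (lo1 q); first by lia.
have hs : 0 < lo1 q <= n by lia.
have [_ _ /(_ es2) []] := lo1P hs.
  by have [] := lo_int hp; lia.
have := @key_between p (lo1 q).-1 q.
by rewrite es3 -e2; lia.
Qed.

Lemma refines_intervals : intervals lo1.
Proof. by move=> r hr; have [h1 h2 _] := lo1P hr; split=> // q /h2 []. Qed.

(** A rank in another run of the same old interval has lcp at most half the key of [p], and ranks of
    one run agree at least that far. *)
Lemma refines_nested : nested lo1.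
Proof.
move=> p q r hp hq hr pq /(refines_eq hp hq) [e1 e2] /eqP ne.
case: (eqVneq (lo r) (lo p)) => [e|]; last exact: lo_nested.
have nk : rank_key p == rank_key r = false.
  by apply/eqP => k; apply: ne; apply/(refines_eq hr hp).
have npr : p != r by apply/eqP => pr; subst r; rewrite eqxx in nk.
have := key_dist hp hr npr (esym e); rewrite nk => ->.
by have := key_dist hp hq pq e1; rewrite e2 eqxx; lia.
Qed.

(** A run of at least two ranks lies strictly on one side of the middle rank. *)
Lemma refines_small sz : small lo sz -> small lo1 (sz %/ 2).
Proof.
move=> sm p q p0 pq qn /refines_eq [||e1 e2]; [by lia|by lia|].
have hp : 0 < p <= n by lia.
have hq : 0 < q <= n by lia.
have [m1 m2] := mid_bound hp; have [h1 h2 _] := hiP hp; have [k1 k2] := lo_int hp.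
have [h1' _ _] := hiP hq; have [k1' _] := lo_int hq; have hE := hi_eq hp hq e1.
have e2' : pivot_key (mid p) p = pivot_key (mid p) q.
  by rewrite {2}(mid_eq hp hq e1).
have := pivot_key_side p0 pq qn m2 e2'.
have := sm (lo p) (hi p); rewrite k2 ?h2; try lia.
rewrite /mid in m1 m2 *; lia.
Qed.

(** * Records between different runs, found by stacks of increasing keys *)

Definition mates x y := 0 < y <= n /\ lo (rk y) = lo (rk x).

Definition position_key x := rank_key (rk x).

Lemma lc_key x y : 0 < x <= n -> mates x y -> x != y ->
  if position_key x == position_key y then is_true (position_key x %/ 2 <= lc x y)
  else lc x y = (minn (position_key x) (position_key y)) %/ 2.
Proof.
move=> hx [hy e] ne; have [rx sx] := rkP hx; have [ry sy] := rkP hy.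
have nr : rk x != rk y by apply/eqP => er; move: ne; rewrite -sx -sy er eqxx.
by have := key_dist rx ry nr (esym e); rewrite /dist sx sy.
Qed.

Lemma lc_outside x y z : 0 < x <= n -> x < z <= n.+1 -> mates x y -> x != y ->
  ~ mates x z -> lc x z <= lc x y.
Proof.
move=> hx hz [hy e] ne nz; case: (eqVneq z n.+1) => [->|nn]; first by rewrite lc_end.
have hz' : 0 < z <= n by lia.
have [rx sx] := rkP hx; have [ry sy] := rkP hy; have [rz sz] := rkP hz'.
have nr : rk x != rk y by apply/eqP => er; move: ne; rewrite -sx -sy er eqxx.
have := lo_nested rx ry rz nr (esym e); rewrite /dist sx sy sz; apply.
by apply/eqP => ez; apply: nz.
Qed.

(** What is done for [x] when the candidate is [c]: earlier rounds covered everything outside of the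
    interval, the current one everything before [c]. *)
Definition treated x c k := ~ mates x k \/ k < c.

(** The treated records after [k] are outside of the interval, where [lc_outside] bounds their lcps
    as [emit_step] demands. *)
Lemma treated_emit x k o last : 0 < x <= n -> x < k -> mates x k ->
  emitted n lc x (treated x k) o last ->
  emitted n lc x (fun k' => treated x k k' \/ k' = k)
    (if lc x k < last then o else (k + lc x k - x, lc x k) :: o)
    (if lc x k < last then last else (lc x k).+1).
Proof.
move=> hx xk mk em; apply: emit_step em _ _ _ _.
- by case: mk; lia.
- by case=> //; lia.
- by move=> k' _ lt; right.
- move=> k' [k'P _] [nm|] lt; last by lia.
  by apply: lc_outside => //; lia.
Qed.

(** The null pointer is read as the end of the string. *)
Definition none_or_pos c := if c == 0 then n.+1 else c.

(* z is the first mate of y after y with a larger key (0 if there is none). *)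
Definition next_greater y z :=
  (z <> 0 -> y < z /\ mates y z /\ position_key y < position_key z) /\
  forall u, y < u < none_or_pos z -> mates y u -> position_key u <= position_key y.

(** This describes the top of a stack: every scanned position is pushed, so the top is the last one
    scanned. *)
Definition first_after x r z :=
  (z <> 0 -> [/\ x < z, 0 < z <= n & lo (rk z) = lo r]) /\
  forall u, x < u < none_or_pos z -> 0 < u <= n -> lo (rk u) <> lo r.

Lemma matesC x y : 0 < x <= n -> mates x y -> mates y x.
Proof. by move=> hx [hy e]. Qed.

Lemma mates_trans x y z : mates x y -> mates y z -> mates x z.
Proof. by case=> hy e [hz e']; split=> //; rewrite e'. Qed.

(** The mates skipped between [k] and [z] have keys at most that of [k], which is below that of [x];
    so they match [x] no further than [k] does and are no records. *)
Lemma treated_next x k z o last : 0 < x <= n -> x < k -> mates x k ->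
  position_key k < position_key x -> next_greater k z ->
  emitted n lc x (fun k' => treated x k k' \/ k' = k) o last ->
  emitted n lc x (treated x (none_or_pos z)) o last.
Proof.
move=> hx xk mk kx [z1 z2]; apply: emitted_ext => k' [k'P k'm]; split.
  have kz : k < none_or_pos z.
    by rewrite /none_or_pos; case: eqP => [_|/z1 []]; [case: mk|]; lia.
  by case=> [[|]|->]; [left|right; lia|right].
case=> [|lt]; first by left; left.
case: (ltngtP k' k) => c; [by left; right| |by right].
left; left => mk'.
have := z2 k'; have := k'm k; have := lc_key hx mk _; have := lc_key hx mk' _.
have -> : x != k by lia.
have -> : x != k' by lia.
move=> /(_ isT) e1 /(_ isT) e2 h1 h2.
have := h2 _ (mates_trans (matesC hx mk) mk').
by move: e1 e2; case: ifP; case: ifP; lia.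
Qed.

Definition all_below x c :=
  forall y, x < y < none_or_pos c -> mates x y -> position_key y < position_key x.

Lemma refined_mates x k : 0 < x <= n -> 0 < k <= n ->
  lo1 (rk k) = lo1 (rk x) <-> mates x k /\ position_key k = position_key x.
Proof.
move=> hx hk; have [rx _] := rkP hx; have [rk' _] := rkP hk.
by split=> [/(refines_eq rk' rx) []|[[_ e1] e2]] //; apply/(refines_eq rk' rx).
Qed.

(** Between rounds, exactly these records have been output. It includes n + 1, which belongs to no
    interval. *)
Definition separated (lo : nat -> nat) x k :=
  ~ (0 < k <= n /\ lo (rk k) = lo (rk x)).

Lemma separated_mates x k : 0 < x <= n ->
  separated lo1 x k <-> ~ (mates x k /\ position_key k = position_key x).
Proof.
move=> hx; split=> h h'; apply: h.
  by split; [case: h' => -[]|apply/refined_mates => //; case: h' => -[]].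
by case: h' => hk /(refined_mates hx hk).
Qed.

Lemma treated_all x o last : 0 < x <= n -> all_below x 0 ->
  emitted n lc x (treated x (none_or_pos 0)) o last ->
  emitted n lc x (separated lo1 x) o last.
Proof.
move=> hx ab; apply: emitted_ext => k [kP _]; rewrite separated_mates //.
split=> [_ [mk e]|_]; first by have := ab k _ mk; case: mk; rewrite /none_or_pos /=; lia.
case: (ltngtP k n.+1) => c; [by right| by lia|left].
by case; lia.
Qed.

(** [k] already matches [x] up to half the key of [x], and a mate from another run cannot match
    further. So no later mate outside of the run of [x] is a record. *)
Lemma treated_stop x k o last : 0 < x <= n -> x < k -> mates x k ->
  position_key x <= position_key k -> all_below x k ->
  emitted n lc x
    (fun k' => treated x k k' \/ k' = k /\ position_key k <> position_key x) o last ->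
  emitted n lc x (separated lo1 x) o last.
Proof.
move=> hx xk mk kx ab; apply: emitted_ext => k' [k'P k'm]; rewrite separated_mates //.
have kE : none_or_pos k = k by rewrite /none_or_pos; case: eqP; lia.
split=> [h [mk' e]|h].
  case: h => [[//|lt]|[ek ne]]; last by rewrite -ek in ne.
  by have := ab k' _ mk'; rewrite kE; lia.
case: (ltngtP k' k) => c; first by left; right.
  left; left => mk'; apply: h; split=> //.
  apply/eqP; apply/negPn/negP => /eqP ne.
  have := k'm k; have := lc_key hx mk _; have := lc_key hx mk' _.
  have -> : x != k by lia.
  have -> : x != k' by lia.
  by move=> /(_ isT) e1 /(_ isT) e2; move: e1 e2; case: ifP; case: ifP; lia.
by right; split=> // e; apply: h; rewrite c.
Qed.

(* y is on the stack of its group when the positions above x have been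
   scanned. *)
Definition on_stack x y :=
  (x < y) && all (fun u => (lo (rk u) == lo (rk y)) ==> (position_key u < position_key y))
                 (iota x.+1 (y - x.+1)).

(** The total size of all stacks, for the amortized analysis. *)
Definition potential x := count (on_stack x) (iota 1 n).

Definition poppable x c y :=
  [&& on_stack x y, lo (rk y) == lo (rk x), position_key y < position_key x & c <= y].

Definition pops x c := count (poppable x c) (iota 1 n).

Lemma aliveP x y : 0 < x <= n -> mates x y ->
  on_stack x y <-> x < y /\
    forall u, x < u < y -> mates x u -> position_key u < position_key y.
Proof.
move=> hx [hy e]; split.
  move=> /andP[xy /allP h]; split=> // u uP [hu eu].
  by have := h u; rewrite mem_iota e eu eqxx /=; apply; lia.
case=> xy h; rewrite /on_stack xy /=; apply/allP => u; rewrite mem_iota => uP.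
by apply/implyP => /eqP eu; apply: h; [lia|split; [lia|rewrite eu]].
Qed.

Lemma none_or_posE k : 0 < k -> none_or_pos k = k.
Proof. by rewrite /none_or_pos; case: eqP; lia. Qed.

Lemma before_next x k z u : 0 < x -> x < k -> all_below x k ->
  next_greater k z -> mates x k -> x < u < none_or_pos z -> mates x u ->
  position_key u <= position_key k \/ u < k /\ position_key u < position_key x.
Proof.
move=> x0 xk ab [_ z2] mk uP mu; case: (ltngtP u k) => c.
- by right; split=> //; apply: ab => //; rewrite none_or_posE; lia.
- left; apply: z2; first by lia.
  by case: mk => hk ek; case: mu => hu eu; split=> //; rewrite eu.
- by left; rewrite c.
Qed.

Lemma all_below_next x k z : 0 < x -> x < k -> mates x k ->
  position_key k < position_key x -> all_below x k -> next_greater k z -> all_below x z.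
Proof.
move=> x0 xk mk kx ab nz y yP my.
by have := before_next x0 xk ab nz mk yP my; lia.
Qed.

(** Following the link of a stack entry leads to the next stack entry, since everything in between
    has a smaller key than [z]. *)
Lemma alive_next x k z : 0 < x <= n -> x < k -> mates x k -> on_stack x k ->
  next_greater k z -> z <> 0 -> [/\ x < z, mates x z & on_stack x z].
Proof.
move=> hx xk mk al [z1 z2] nz; have [kz [mz kez]] := z1 nz.
have mxz := mates_trans mk mz.
split=> //; first by lia.
apply/aliveP => //; split=> [|u uP mu]; first by lia.
have [_ bl] := (aliveP hx mk).1 al.
case: (ltngtP u k) => c; [by have := bl u _ mu; lia| |by rewrite c].
have := z2 u; rewrite none_or_posE; last by lia.
by move=> /(_ _ (mates_trans (matesC hx mk) mu)); lia.
Qed.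

(** When keys tie, [x] replaces [k] on the stack and inherits its link, so that keys stay strictly
    increasing. *)
Lemma next_greater_equal x k z : 0 < x -> x < k -> mates x k ->
  position_key k = position_key x -> all_below x k -> next_greater k z ->
  next_greater x z.
Proof.
move=> x0 xk mk kx ab nz; split=> [z0|u uP mu].
  have [kz [mz ?]] := nz.1 z0.
  by split; [lia|split; [exact: mates_trans mk mz|lia]].
by have := before_next x0 xk ab nz mk uP mu; lia.
Qed.

Lemma next_greater_stop x k : 0 < x -> all_below x k ->
  (k <> 0 -> [/\ x < k, mates x k & position_key x < position_key k]) -> next_greater x k.
Proof.
by move=> x0 ab h; split=> [/h[]//|u uP mu]; apply: ltnW; apply: ab.
Qed.

Lemma first_candidate x k : 0 < x <= n -> first_after x (rk x) k ->
  [/\ k <> 0 -> [/\ x < k, mates x k & on_stack x k], all_below x k &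
      forall o last, emitted n lc x (separated lo x) o last ->
        emitted n lc x (treated x (none_or_pos k)) o last].
Proof.
move=> hx [k1 k2]; split.
- move=> k0; have [xk hk ek] := k1 k0; split=> //.
  apply/aliveP => //; split=> // u uP [hu eu].
  by case: (k2 u _ hu eu); rewrite none_or_posE; lia.
- by move=> y yP [hy ey]; case: (k2 y yP hy ey).
move=> o last; apply: emitted_ext => y [yP _]; split=> [|[//|yk] [hy ey]].
  by left.
by apply: (k2 y _ hy ey); lia.
Qed.

Lemma first_after_step x r z : 0 < x <= n -> 0 < r <= n ->
  (lo r <> lo (rk x) -> first_after x r z) ->
  first_after x.-1 r (if lo r == lo (rk x) then x else z).
Proof.
move=> hx hr h; case: eqP => [e|ne].
  split=> [_|u]; first by split; [lia|lia|].
  by rewrite none_or_posE; lia.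
have [h1 h2] := h ne; split=> [/h1[? ? ?]|u uP hu eu]; first by split; lia.
case: (eqVneq u x) => [e|nu]; first by apply: ne; rewrite -e eu.
by apply: (h2 u) => //; lia.
Qed.

(** The candidate [k] itself is counted before the step and not after it. *)
Lemma pops_next x k z : 0 < x <= n -> mates x k -> on_stack x k ->
  position_key k < position_key x -> next_greater k z ->
  pops x (none_or_pos z) < pops x k.
Proof.
move=> hx mk al kx [z1 _].
have kz : k < none_or_pos z.
  by rewrite /none_or_pos; case: eqP => [_|/z1 []]; [case: mk|]; lia.
have kI : k \in iota 1 n by rewrite mem_iota; case: mk; lia.
rewrite /pops; elim: (iota 1 n) kI => //= y s IH.
have sub : poppable x (none_or_pos z) y <= poppable x k y.
  rewrite /poppable; case: on_stack => //=; case: eqP => //= _.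
  by case: ltnP => //= _; lia.
rewrite inE => /orP[/eqP ky|/IH]; last by lia.
have -> : poppable x k y.
  by rewrite -ky /poppable al kx leqnn; case: mk => _ ->; rewrite eqxx.
have -> : poppable x (none_or_pos z) y = false.
  by rewrite /poppable -ky (leqNgt (none_or_pos z)) kz !andbF.
rewrite add0n add1n ltnS; apply: sub_count => u.
rewrite /poppable => /and4P[-> -> ->] /=; lia.
Qed.

(** Position by position: a popped entry leaves its stack, and only [x] enters one. *)
Lemma potential_step x : 0 < x <= n ->
  potential x.-1 + pops x 0 <= (potential x).+1.
Proof.
move=> hx.
have cx : count (pred1 x) (iota 1 n) <= 1.
  by rewrite count_uniq_mem ?iota_uniq //; case: (_ \in _).
have H y : on_stack x.-1 y + poppable x 0 y <= on_stack x y + (y == x).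
  rewrite /poppable /on_stack prednK; last by lia.
  rewrite andbT.
  case: (ltngtP x y) => c.
  - have -> : y - x = (y - x.+1).+1 by lia.
    rewrite /= eq_sym; case: all; rewrite ?andbF ?andbT //=.
    by case: eqP => //= _; case: (ltngtP (position_key x) (position_key y)).
  - by [].
  - by rewrite c subnn.
have L (a b e f : pred nat) s : (forall y, a y + b y <= e y + f y) ->
    count a s + count b s <= count e s + count f s.
  by move=> h; elim: s => //= y s IH; have := h y; lia.
rewrite -[(potential x).+1]addn1.
apply: leq_trans (L (on_stack x.-1) (poppable x 0) (on_stack x) (pred1 x) (iota 1 n) H) _.
by rewrite leq_add2l.
Qed.

End Refine.
End Groups.

(** * The program *)

(* Arrays: the inverse of the suffix array; for each rank, the ends of its
   interval and its key; for the last rank of each interval, the top of its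
   stack (0 if empty); for each position, the one below it on the stack and one
   more than the length of the last border output for it. *)
Notation RNK := 0 (only parsing).
Notation LO := 1 (only parsing).
Notation HI := 2 (only parsing).
Notation KEY := 3 (only parsing).
Notation TOP := 4 (only parsing).
Notation DOWN := 5 (only parsing).
Notation LAST := 6 (only parsing).
Notation POS := 7 (only parsing).
Notation CUR := 8 (only parsing).
Notation SIZE := 9 (only parsing).
Notation CAND := 10 (only parsing).
Notation TMP := 11 (only parsing).

Definition get v := ReadMem v (Const 0).
Definition set v e := WriteMem v (Const 0) e.
Definition add := Binop OpAdd.
Definition sub := Binop OpSub.
Definition mul := Binop OpMul.
Definition half e := Binop OpDiv e (Const 2).
Definition eq_expr := Binop OpEq.
Definition lt_expr := Binop OpLt.
Definition key_at e := ReadMem KEY (ReadMem RNK e).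

Definition init_body :=
  Seq (WriteMem RNK (SAEntry (get POS)) (get POS))
 (Seq (WriteMem LO (get POS) (Const 1))
      (set POS (sub (get POS) (Const 1)))).

(** The sentinel at n + 1 closes the last interval. The pair (1, 0) is output here because its
    record n + 1 lies in no interval. *)
Definition init_end :=
  Seq (WriteMem LO (add InputLength (Const 1)) (add InputLength (Const 1)))
 (Seq (If InputLength
         (Seq (PushFront InputLength (Const 1) (Const 0))
              (WriteMem LAST InputLength (Const 1)))
         Skip)
      (set SIZE InputLength)).

Definition set_mid :=
  set TMP (half (add (ReadMem LO (get POS)) (ReadMem HI (get POS)))).

Definition next_pos := add (get POS) (Const 1).

Definition set_hi :=
  If (eq_expr (ReadMem LO next_pos) next_pos)
     (WriteMem HI (get POS) (get POS))
     (WriteMem HI (get POS) (ReadMem HI next_pos)).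

(** A running minimum of [LCP] entries that restarts from n at the pivot. Keys written right of the
    pivot are provisional; [right_key] overwrites them. *)
Definition left_key :=
  Seq (WriteMem TOP (get POS) (Const 0))
 (Seq set_mid
 (Seq (If (lt_expr (get POS) (get TMP))
          (If (lt_expr (LCPEntry next_pos) (get CUR))
              (set CUR (LCPEntry next_pos))
              Skip)
          (set CUR InputLength))
 (Seq (WriteMem KEY (get POS) (mul (Const 2) (get CUR)))
      (set POS (sub (get POS) (Const 1)))))).

Definition left_body := Seq set_hi left_key.

Definition right_key :=
  Seq set_mid
      (If (lt_expr (get TMP) (get POS))
          (Seq (If (lt_expr (LCPEntry (get POS)) (get CUR))
                   (set CUR (LCPEntry (get POS)))
                   Skip)
               (WriteMem KEY (get POS) (add (mul (Const 2) (get CUR)) (Const 1))))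
          (set CUR InputLength)).

Definition prev_pos := sub (get POS) (Const 1).

(** The refinement is done in place: the cell at [POS] is still old, while the cell before it
    already holds the start of a new run. *)
Definition set_lo :=
  Seq (If (eq_expr (ReadMem LO (get POS)) (get POS))
          Skip
          (If (eq_expr (ReadMem KEY (get POS)) (ReadMem KEY prev_pos))
              (WriteMem LO (get POS) (ReadMem LO prev_pos))
              (WriteMem LO (get POS) (get POS))))
      (set POS next_pos).

Definition right_body := Seq right_key set_lo.

Definition emit e :=
  Seq (set TMP (half e))
      (If (lt_expr (get TMP) (ReadMem LAST (get POS)))
          Skip
          (Seq (PushFront (get POS)
                  (sub (add (get CAND) (get TMP)) (get POS)) (get TMP))
               (WriteMem LAST (get POS) (add (get TMP) (Const 1))))).

Definition top_index := ReadMem HI (ReadMem RNK (get POS)).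

(** The product acts as a conjunction. Both factors are evaluated, so the key of the null candidate
    is read too; cell 0 of [RNK] holds 0, which keeps that access in bounds. *)
Definition pop_guard :=
  mul (get CAND) (lt_expr (key_at (get CAND)) (key_at (get POS))).

Definition pop_body :=
  Seq (emit (key_at (get CAND))) (set CAND (ReadMem DOWN (get CAND))).

Definition scan_start := set CAND (ReadMem TOP top_index).

Definition scan_stop :=
  If (get CAND)
     (If (eq_expr (key_at (get CAND)) (key_at (get POS)))
         (set CAND (ReadMem DOWN (get CAND)))
         (emit (key_at (get POS))))
     Skip.

Definition scan_store :=
  Seq (WriteMem DOWN (get POS) (get CAND))
 (Seq (WriteMem TOP top_index (get POS))
      (set POS prev_pos)).

Definition scan_end := Seq scan_stop scan_store.

Definition scan_body :=
  Seq scan_start (Seq (While pop_guard pop_body) scan_end).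

Definition init_loop := Seq (set POS InputLength) (While (get POS) init_body).

Definition left_loop := Seq (set POS InputLength) (While (get POS) left_body).

Definition right_loop :=
  Seq (set POS (Const 1))
      (While (lt_expr (get POS) (add InputLength (Const 1))) right_body).

Definition scan_loop := Seq (set POS InputLength) (While (get POS) scan_body).

Definition round :=
  Seq left_loop (Seq right_loop (Seq scan_loop (set SIZE (half (get SIZE))))).

Definition mrc_program :=
  Seq init_loop (Seq init_end (While (lt_expr (Const 1) (get SIZE)) round)).

(* The cost of a pop occurs twice because each position pays for its own removal
   from the stack and for the last test of the inner loop. *)
Definition scan_time := max_time scan_start + max_time scan_end +
  2 * (max_time pop_body + (cost pop_guard).+1) + 3.

(** The 3 before each loop pays for setting [POS]; the 3 and 7 added to the bodies, and the 3 after
    [scan_time * n], pay for loop tests. *)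
Definition round_time n :=
  (3 + (max_time left_body + 3) * n.+1) +
  ((3 + (max_time right_body + 7) * n.+1) +
   ((3 + (scan_time * n + 3)) + max_time (set SIZE (half (get SIZE))))).

Definition total_time n :=
  (3 + (max_time init_body + 3) * n.+1) +
  (max_time init_end + (round_time n + 5) * (trunc_log 2 n).+1).

Section Program.
Variables (d : Order.disp_t) (A : orderType d) (w : seq A) (SAs LCPs : seq nat).
Hypothesis saP : is_suffix_array w SAs.
Hypothesis lcpP : is_lcp_array w SAs LCPs.
Variable b : nat.
Hypothesis bP : forall v, v <= 4 * size w + 15 -> v < 2 ^ b.

Notation n := (size w).
Notation lc := (lcp_at w).
Notation SA := (entry 0 SAs).
Definition rank x := (index x SAs).+1.
Notation rk := rank.
Notation I := (Input w SAs LCPs).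
Notation dist := (dist lc SA).
Notation key := (rank_key n lc SA).

Lemma size_SA : size SAs = n.
Proof. by have [/perm_size -> _] := saP; rewrite size_iota. Qed.

Lemma rankP x : 0 < x <= n -> 0 < rk x <= n /\ SA (rk x) = x.
Proof.
move=> hx; have [/perm_mem pm _] := saP.
have xS : x \in SAs by rewrite pm mem_iota; lia.
by split; [rewrite /= -size_SA index_mem|exact: nth_index].
Qed.

Lemma SA_range r : 0 < r <= n -> 0 < SA r <= n /\ rk (SA r) = r.
Proof.
move=> hr; have [pe _] := saP.
have rS : r.-1 < size SAs by rewrite size_SA; lia.
split; first by have := mem_nth 0 rS; rewrite (perm_mem pe) mem_iota add1n ltnS.
have us : uniq SAs by rewrite (perm_uniq pe) iota_uniq.
by rewrite /rank /entry index_uniq // prednK //; case/andP: hr.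
Qed.

Lemma SA_lex p q : 0 < p -> p < q -> q <= n ->
  lex_lt (suffix_at w (SA p)) (suffix_at w (SA q)).
Proof.
move=> p0 pq qn; have [_ so] := saP.
apply: (sorted_ltn_nth _ _ so); rewrite ?inE ?size_SA; try lia.
by move=> x y z; exact: Order.POrderTheory.lt_trans.
Qed.

Lemma lcp_at_mid p q r : 0 < p -> p < q -> q < r -> r <= n ->
  lc (SA p) (SA r) = minn (lc (SA p) (SA q)) (lc (SA q) (SA r)).
Proof.
by move=> p0 pq qr rn; apply: common_prefix_length_lex; apply: SA_lex; lia.
Qed.

Lemma LCP_dist r : 1 < r <= n -> entry 0 LCPs r = dist r.-1 r.
Proof. by move=> hr; have [_ _ ->] := lcpP. Qed.

Lemma size_LCP : size LCPs = n.
Proof. by have [] := lcpP. Qed.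

(** Indices run from the null value 0 to the sentinel n + 1. *)
Definition mem_layout := nseq 7 n.+2 ++ nseq 5 1.
Notation L := (Limits b mem_layout).
Notation runs := (runs L I).

Lemma fitsI v : v <= 4 * n + 15 -> fits L v.
Proof. exact: bP. Qed.

Ltac vc := repeat match goal with
  | |- _ /\ _ => split
  | |- and3 _ _ _ => split
  | |- and4 _ _ _ _ => split
  end; try solve [apply: fitsI; lia | lia].

Ltac reduce := rewrite /in_layout /update /= ?eqb0 ?negbK.

(** * Initialization *)

Record init_inv j s : Prop := InitInv {
  ii_pos : memory s POS 0 = j;
  ii_le : j <= n;
  ii_rnk : forall r, j < r <= n -> memory s RNK (SA r) = r;
  ii_lo : forall r, j < r <= n -> memory s LO r = 1;
  ii_zero : memory s RNK 0 = 0;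
  ii_last : forall x, memory s LAST x = 0;
  ii_out : output s = nseq n [::] }.

Lemma run_init :
  runs init_loop (initial_state n)
    (3 + (max_time init_body + 3) * n.+1) (init_inv 0).
Proof.
apply: (runs_seq (Q1 := init_inv n)).
  apply: runs_wp; rewrite /=; reduce; vc.
  by constructor=> //=; rewrite /update //= => r; lia.
move=> s iv; apply: (runs_for (Inv := init_inv)) iv => {s}.
  by move=> s iv; rewrite /=; reduce; rewrite (ii_pos iv); vc.
move=> j s [hp hj hr hl hz hla ho]; split; rewrite /=; reduce; rewrite ?hp //; vc.
have [h1 h2] := @SA_range j.+1 ltac:(lia).
apply: runs_wp; rewrite /init_body /=; reduce; rewrite hp; vc.
- by rewrite size_SA; lia.
- constructor=> //=; rewrite /update /=; try lia.
  + move=> r rP; case: (eqVneq (SA r) (SA j.+1)) => [e|ne].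
      by rewrite -h2 -e; have [_ ->] := @SA_range r ltac:(lia).
    by apply: hr; case: (eqVneq r j.+1) ne => [->|]; [rewrite eqxx|lia].
  + by move=> r rP; case: eqP => // ne; apply: hl; lia.
  + by case: eqP => // e; lia.
Qed.

(** The state between rounds. By [ri_nested], the records still missing have lcps at least as large
    as those already output. *)
Record round_inv sz s : Prop := RoundInv {
  ri_size : memory s SIZE 0 = sz;
  ri_le : sz <= n;
  ri_rnk : forall x, 0 < x <= n -> memory s RNK x = rk x;
  ri_zero : memory s RNK 0 = 0;
  ri_int : intervals n (memory s LO);
  ri_nested : nested n lc SA (memory s LO);
  ri_small : small n (memory s LO) sz;
  ri_end : memory s LO n.+1 = n.+1;
  ri_out : size (output s) = n;
  ri_em : forall x, 0 < x <= n ->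
    emitted n lc x (separated n rk (memory s LO) x)
      (entry [::] (output s) x) (memory s LAST x) }.

Lemma emitted_last : 
  emitted n lc n (separated n rk (fun _ => 1) n) [:: (1, 0)] 1.
Proof.
have rE k : next_record n lc n k -> k = n.+1 by case; lia.
have rn : next_record n lc n n.+1 by split=> //; lia.
have ln := @lcp_at_end _ w n.
split=> //.
- move=> l c; rewrite inE; split=> [/eqP[-> ->]|[k [/rE-> _ -> ->]]].
    by exists n.+1; rewrite ln; split=> //; [move=> []; lia|lia].
  by rewrite ln xpair_eqE; lia.
- by move=> k /rE->; rewrite ln.
- by right; exists n.+1; rewrite ln; split=> // -[]; lia.
Qed.

(** Initially all positions form one interval, so only n + 1 is separated; its lcp is 0, and
    position n precedes it, so it is no record. *)
Lemma emitted_first x : 0 < x < n ->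
  emitted n lc x (separated n rk (fun _ => 1) x) [::] 0.
Proof.
move=> hx.
have no k : next_record n lc x k -> ~ separated n rk (fun _ => 1) x k.
  move=> [kP km] sp; case: (ltngtP k n.+1) => c; [by apply: sp; lia|lia|].
  by have := km n; rewrite c (@lcp_at_end _ w x) => /(_ ltac:(lia)); rewrite ltn0.
split=> //; last by left.
- by move=> l c; split=> // -[k [/no]].
- by move=> k /no.
Qed.

Lemma run_init_end s : init_inv 0 s ->
  runs init_end s (max_time init_end) (round_inv n).
Proof.
case=> hp _ hr hl hz hla ho; apply: runs_wp; rewrite /init_end /=; reduce.
have rkE x : 0 < x <= n -> memory s 0 x = rk x.
  by move=> hx; have [h <-] := rankP hx; rewrite hr // ; have [_ ->] := SA_range h.
set P := fun m o => round_inv n (State m o).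
have init m o : m SIZE 0 = n -> m RNK = memory s RNK ->
    (forall r, 0 < r <= n -> m LO r = 1) -> m LO n.+1 = n.+1 -> size o = n ->
    (forall x, 0 < x < n -> entry [::] o x = [::] /\ m LAST x = 0) ->
    (0 < n -> entry [::] o n = [:: (1, 0)] /\ m LAST n = 1) -> P m o.
  move=> e1 e2 e3 e4 e5 e6 e7; constructor=> //=.
  - by move=> x; rewrite e2; exact: rkE.
  - by rewrite e2.
  - by move=> r hr'; rewrite e3 //; split; [lia|move=> q ?; apply: e3; lia].
  - by move=> p q r hp' hq hr'; rewrite !e3 ?eqxx.
  - by move=> p q; lia.
  - move=> x hx.
    have E o' l : emitted n lc x (separated n rk (fun _ => 1) x) o' l ->
                  emitted n lc x (separated n rk (m LO) x) o' l.
      apply: emitted_ext => k _; have [h _] := rankP hx.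
      split=> sp [hk e]; apply: sp; split=> //.
      by have [hk' _] := rankP hk; rewrite !e3.
    apply: E; case: (ltngtP x n) => c; [|by lia|].
      by have [|-> ->] := e6 x; [lia|apply: emitted_first; lia].
    by rewrite c; have [|-> ->] := e7; [lia|exact: emitted_last].
have en x : entry [::] (nseq n [::]) x = [::] :> seq (nat * nat).
  by rewrite /entry nth_nseq if_same.
vc; case: eqP => nz /=; vc; apply: init => //=; try by lia.
- by case: eqP; lia.
- by rewrite ho size_nseq.
- by move=> r hr'; case: eqP => [|_]; [lia|exact: hl].
- by case: eqP; lia.
- by rewrite size_push_front ho size_nseq //; lia.
- move=> x hx; rewrite entry_push_front ?ho ?en ?hla; try lia.
  by have -> : (x == n) = false by lia.
- by rewrite entry_push_front ?ho ?en ?hla ?eqxx //; lia.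
Qed.

(** * First pass: ends of the intervals and keys up to the pivots *)

Record left_inv m0 o0 j s : Prop := LeftInv {
  li_pos : memory s POS 0 = j;
  li_le : j <= n;
  li_rnk : memory s RNK = m0 RNK;
  li_lo : memory s LO = m0 LO;
  li_last : memory s LAST = m0 LAST;
  li_size : memory s SIZE = m0 SIZE;
  li_out : output s = o0;
  li_hi : forall q, j < q <= n -> last_of n (m0 LO) q (memory s HI q);
  li_top : forall q, j < q <= n -> memory s TOP q = 0;
  li_key : forall q, j < q <= n -> q <= mid (m0 LO) (memory s HI) q ->
    memory s KEY q = key (m0 LO) (memory s HI) q;
  li_cur : j < n -> j < mid (m0 LO) (memory s HI) j.+1 ->
    memory s CUR 0 = pivot_lcp n lc SA j.+1 (mid (m0 LO) (memory s HI) j.+1) }.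

Lemma LCP_le r : 1 < r <= n -> entry 0 LCPs r <= n.
Proof.
move=> hr; rewrite LCP_dist //; apply: ltnW; apply: (dist_lt (rk := rk)); try lia.
- exact: lcp_at_lt.
- exact: SA_range.
Qed.

Lemma pivot_lcp_bound q c : 0 < q <= n -> 0 < c <= n ->
  pivot_lcp n lc SA q c <= n.
Proof.
by apply: (pivot_lcp_le (rk := rk)); [exact: lcp_at_lt|exact: SA_range].
Qed.

Lemma left_lcp_step r c : 0 < r -> r < c -> c <= n ->
  pivot_lcp n lc SA r c =
  minn (entry 0 LCPs r.+1) (pivot_lcp n lc SA r.+1 c).
Proof.
move=> r0 rc cn; rewrite LCP_dist; last by lia.
apply: (pivot_lcp_left (rk := rk)) => //; try exact: SA_range.
- exact: lcp_at_lt.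
- exact: lcp_at_mid.
Qed.

Lemma right_lcp_step r c : 0 < c -> c < r -> r <= n ->
  pivot_lcp n lc SA r c =
  minn (entry 0 LCPs r) (pivot_lcp n lc SA r.-1 c).
Proof.
move=> c0 cr rn; rewrite LCP_dist; last by lia.
rewrite (distC _ (lcp_atC w)).
apply: (pivot_lcp_right (rk := rk)) => //; try lia; try exact: SA_range.
- exact: lcp_atC.
- exact: lcp_at_lt.
- exact: lcp_at_mid.
Qed.

Lemma run_left sz s0 : round_inv sz s0 ->
  runs left_loop s0
    (3 + (max_time left_body + 3) * n.+1)
    (left_inv (memory s0) (output s0) 0).
Proof.
case: s0 => m0 o0 [/= hs hsz hr hz hi hn hsm he ho hem].
apply: (runs_seq (Q1 := left_inv m0 o0 n)).
  apply: runs_wp; rewrite /=; reduce; vc.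
  by constructor=> //= q; lia.
move=> s iv; apply: (runs_for (Inv := left_inv m0 o0)) iv => {s}.
  by move=> s iv; rewrite /=; reduce; rewrite (li_pos iv); vc.
move=> j [m o] [/= hp hj e1 e2 e3 e4 -> h1 h2 h3 h4].
split; try by rewrite /=; reduce; rewrite ?hp //; vc.
have hj1 : 0 < j.+1 <= n by lia.
have fin h c m' : m' POS 0 = j -> m' RNK = m0 RNK -> m' LO = m0 LO ->
    m' LAST = m0 LAST -> m' SIZE = m0 SIZE ->
    m' HI = (fun i => if i == j.+1 then h else m HI i) ->
    (forall i, m' TOP i = if i == j.+1 then 0 else m TOP i) ->
    (forall i, m' KEY i = if i == j.+1 then 2 * c else m KEY i) ->
    m' CUR 0 = c ->
    last_of n (m0 LO) j.+1 h ->
    (j < (m0 LO j.+1 + h) %/ 2 ->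
      c = pivot_lcp n lc SA j.+1 ((m0 LO j.+1 + h) %/ 2)) ->
    left_inv m0 o0 j (State m' o0).
  move=> f1 f2 f3 f4 f5 f6 f7 f8 f9 f10 f11; constructor=> //=; try lia.
  - move=> q hq; rewrite f6; case: eqP => [-> //|ne]; apply: h1; lia.
  - move=> q hq; rewrite f7; case: eqP => // ne; apply: h2; lia.
  - move=> q hq; rewrite f8 f6 /rank_key /mid; case: eqP => [->|ne] le.
      by rewrite f11 // /pivot_key le.
    by apply: h3; [lia|].
  - by move=> _; rewrite f6 f9 /mid eqxx.
pose h := if m0 LO j.+2 == j.+2 then j.+1 else m HI j.+2.
have hP : last_of n (m0 LO) j.+1 h.
  by apply: (last_of_step (h' := m HI j.+2)) => // jn; apply: h1; lia.
have [hb hlo _] := hP; have [hl _] := hi _ hj1.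
set M := (m0 LO j.+1 + h) %/ 2.
have hM : m0 LO j.+1 <= M <= h by rewrite /M; lia.
(* Left of the pivot, the next rank belongs to the same interval and has the same pivot, so [CUR]
   holds its pivot lcp. *)
have step : j.+1 < M -> [/\ entry 0 LCPs j.+2 <= n, m CUR 0 <= n &
    minn (entry 0 LCPs j.+2) (m CUR 0) = pivot_lcp n lc SA j.+1 M].
  move=> c; have lE : m0 LO j.+2 = m0 LO j.+1 by apply: hlo; lia.
  have hE : m HI j.+2 = h by rewrite /h lE; case: eqP => //; lia.
  have ME : mid (m0 LO) (m HI) j.+2 = M by rewrite /mid lE hE.
  rewrite left_lcp_step //; try lia.
  rewrite h4 ?ME; try lia.
  split=> //; last by apply: pivot_lcp_bound; lia.
  by apply: LCP_le; lia.
apply: runs_wp; apply: wp_seq; set Q := wp _ _ left_key _.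
have hQ : Q (State (update m HI j.+1 h) o0).
  rewrite /Q /left_key /set_mid /next_pos /=; reduce.
  rewrite hp e2 !addn1 subn1 /= eqxx -/M size_LCP; vc.
  have Mn : j < M -> j.+1 < M \/ M = j.+1 by lia.
  case: (ltnP j.+1 M) => c /=; [have [l1 l2 l3] := step c|]; vc.
  + case: ltnP => c2 /=; vc.
    * by apply: (fin h (entry 0 LCPs j.+2)) => //; rewrite -/M -l3; lia.
    * by apply: (fin h (m CUR 0)) => //; rewrite -/M -l3; lia.
  + apply: (fin h n) => //; rewrite -/M => /Mn[|->]; first by lia.
    by rewrite /pivot_lcp eqxx.
move: Q hQ => Q; rewrite /set_hi /next_pos /=; reduce; rewrite hp e2 !addn1 /h.
by case: eqP => _ hQ; vc.
Qed.

(** * Second pass: keys right of the pivots and the refined partition *)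

Record right_inv lo m1 o1 r s : Prop := RightInv {
  ti_pos : memory s POS 0 = r;
  ti_le : 0 < r <= n.+1;
  ti_rnk : memory s RNK = m1 RNK;
  ti_hi : memory s HI = m1 HI;
  ti_top : memory s TOP = m1 TOP;
  ti_last : memory s LAST = m1 LAST;
  ti_size : memory s SIZE = m1 SIZE;
  ti_out : output s = o1;
  ti_lo : forall q, r <= q <= n.+1 -> memory s LO q = lo q;
  ti_ref : forall q, 0 < q < r -> refines n lc SA lo (m1 HI) (memory s LO) q;
  ti_key : forall q, 0 < q <= n -> q < r \/ q <= mid lo (m1 HI) q ->
    memory s KEY q = key lo (m1 HI) q;
  ti_cur : 1 < r -> mid lo (m1 HI) r.-1 < r ->
    memory s CUR 0 = pivot_lcp n lc SA r.-1 (mid lo (m1 HI) r.-1) }.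

Lemma run_right sz s0 s1 : round_inv sz s0 ->
  left_inv (memory s0) (output s0) 0 s1 ->
  runs right_loop s1
    (3 + (max_time right_body + 7) * n.+1)
    (right_inv (memory s0 LO) (memory s1) (output s0) n.+1).
Proof.
case: s0 => m0 o0 [/= hs hsz hr hz hi hn hsm he ho hem].
case: s1 => m1 o1 [/= _ _ l1 l2 l3 l4 -> lh _ lk _].
set lo := m0 LO; set hg := m1 HI.
have hgP r : 0 < r <= n -> last_of n lo r (hg r) by apply: lh.
have loP r : 0 < r <= n -> 0 < lo r <= r by move=> h; have [] := hi r h.
(* [runs_for] counts down, so this ascending loop is indexed by the number of ranks left. *)
pose Inv j s := j <= n /\ right_inv lo m1 o0 (n.+1 - j) s.
apply: (runs_seq (Q1 := Inv n)).
  apply: runs_wp; rewrite /=; reduce; vc.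
  split; first by [].
  rewrite subSnn; constructor=> //=; try lia.
  - by move=> q _; rewrite l2.
  - by move=> q hq [|c]; [lia|exact: lk].
move=> s iv; apply: (runs_for (Inv := Inv)) iv => {s}.
  move=> s [_ iv]; rewrite /=; reduce; rewrite (ti_pos iv) subn0.
  by split; [vc|rewrite addn1 ltnn|rewrite subn0 in iv].
move=> j [m o] [jn]; have -> : n.+1 - j.+1 = n - j by lia.
set r := n - j; case=> /= hp hr1 e1 e2 e3 e4 e5 -> h1 h2 h3 h4.
have hrn : 0 < r <= n by lia.
split; try by rewrite /=; reduce; rewrite ?hp //; vc.
have -> : Inv j = fun s => j <= n /\ right_inv lo m1 o0 r.+1 s.
  by rewrite /Inv /r subSn //; lia.
have [mb1 mb2] := mid_bound hi hgP hrn.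
have hgn : hg r <= n by have [] := hgP r hrn; lia.
have lor : m LO r = lo r by apply: h1; lia.
apply: runs_wp; apply: wp_seq; set Q := wp _ _ set_lo _.
have hQ m' : m' POS 0 = r -> m' RNK = m RNK -> m' LO = m LO -> m' HI = m HI ->
    m' TOP = m TOP -> m' LAST = m LAST -> m' SIZE = m SIZE ->
    (forall i, m' KEY i = if i == r then key lo hg r else m KEY i) ->
    (mid lo hg r <= r -> m' CUR 0 = pivot_lcp n lc SA r (mid lo hg r)) ->
    Q (State m' o0).
  move=> f1 f2 f3 f4 f5 f6 f7 f8 f9.
  have fin l m2 : m2 POS 0 = r.+1 -> m2 RNK = m RNK -> m2 HI = m HI ->
      m2 TOP = m TOP -> m2 LAST = m LAST -> m2 SIZE = m SIZE ->
      m2 KEY = m' KEY -> m2 CUR = m' CUR ->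
      (forall i, m2 LO i = if i == r then l else m LO i) ->
      l = (if lo r == r then r else
           if key lo hg r == key lo hg r.-1 then m LO r.-1 else r) ->
      right_inv lo m1 o0 r.+1 (State m2 o0).
    move=> g1 g2 g3 g4 g5 g6 g7 g8 g9 lE.
    have ref q : 0 < q < r -> refines n lc SA lo hg (m2 LO) q.
      move=> hq; apply: refines_ext (h2 q hq) => q' le.
      by rewrite g9; case: eqP => //; lia.
    constructor=> //=; rewrite ?g2 ?g3 ?g4 ?g5 ?g6 ?g8 //; try lia.
    - by move=> q hq; rewrite g9 ifN ?h1 //; lia.
    - move=> q hq; case: (ltngtP q r) => c; [apply: ref; lia|lia|].
      rewrite c; apply: refines_step => //; rewrite !g9 eqxx.
      by have -> : (r.-1 == r) = false by lia.
    - move=> q hq c; rewrite g7 f8; case: eqP => [-> //|ne].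
      by apply: h3 => //; case: c; [left; lia|right].
  have keyr : lo r != r -> m' KEY r.-1 = key lo hg r.-1.
    move=> c; have := loP r hrn => c2.
    by rewrite f8 ifN ?h3 //; [lia|left; lia|lia].
  rewrite /Q /set_lo /prev_pos /next_pos /=; reduce.
  rewrite f1 f3 lor (f8 r) eqxx addn1 subn1; vc.
  case: (eqVneq (lo r) r) => c /=; vc.
    apply: (fin r) => //=; last by rewrite c eqxx.
    by move=> i; rewrite f3; case: eqP => [->|//]; rewrite lor c.
  rewrite keyr //.
  case: (eqVneq (key lo hg r) (key lo hg r.-1)) => c2 /=; vc.
  - apply: (fin (m LO r.-1)) => //=; last by rewrite (negbTE c) c2 eqxx.
    by move=> i; rewrite f3.
  - apply: (fin r) => //=; last by rewrite (negbTE c) (negbTE c2).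
    by move=> i; rewrite f3.
have lorn : lo r <= n by have := loP r hrn; lia.
have midn : mid lo hg r <= n by case/andP: mb2.
have step : mid lo hg r < r -> [/\ entry 0 LCPs r <= n, m CUR 0 <= n &
    minn (entry 0 LCPs r) (m CUR 0) = pivot_lcp n lc SA r (mid lo hg r)].
  move=> c; have midp : 0 < mid lo hg r by case/andP: mb2.
  have hr' : 0 < r.-1 <= n by lia.
  (* The pivot lies before [r], so [r.-1] is still in the interval and has the same pivot. *)
  have el : lo r.-1 = lo r.
    have [_ il] := hi r hrn; apply: il.
    by case/andP: mb1 => /leq_ltn_trans /(_ c); rewrite -/lo; lia.
  have em := mid_eq hgP hr' hrn el.
  have rn : r <= n by lia.
  have r1 : 1 < r by lia.
  have c' : mid lo hg r.-1 < r by rewrite em.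
  rewrite (right_lcp_step midp c rn) (h4 r1 c') -/hg em.
  split=> //; first by apply: LCP_le; rewrite r1.
  exact: pivot_lcp_bound.
move: Q hQ => Q hQ; rewrite /right_key /set_mid /=; reduce.
rewrite hp lor e2 -/hg -/(mid lo hg r) size_LCP; vc.
case: ltnP => c /=; [have [g1 g2 g3] := step c|]; vc.
- by case: ltnP => c2 /=; vc; apply: hQ => //= [i|_];
    rewrite -?g3 /rank_key /pivot_key ?(leqNgt r) ?c -?g3 /=; try case: eqP => // _; lia.
- apply: hQ => //= [i|c2].
    case: eqP => // ->; rewrite h3 //; last by right.
  have -> : mid lo hg r = r by lia.
  by rewrite /pivot_lcp eqxx.
Qed.

Lemma lc_lt i k : 0 < i -> 0 < k -> i != k -> i <= n -> k <= n -> lc i k < n.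
Proof. exact: lcp_at_lt. Qed.

(** * The scan of the positions with one stack per interval *)

Section Scan.
Variables (m2 : nat -> nat -> nat) (lo hi : nat -> nat).
Hypothesis loP : intervals n lo.
Hypothesis loN : nested n lc SA lo.
Hypothesis hiP : forall r, 0 < r <= n -> last_of n lo r (hi r).
Hypothesis refP : forall r, 0 < r <= n -> refines n lc SA lo hi (m2 LO) r.
Hypothesis rnkE : forall x, 0 < x <= n -> m2 RNK x = rk x.
Hypothesis rnk0 : m2 RNK 0 = 0.
Hypothesis hiE : m2 HI = hi.
Hypothesis keyE : forall q, 0 < q <= n -> m2 KEY q = key lo hi q.

Notation poskey := (position_key n lc SA rk lo hi).
Notation mates := (mates n rk lo).
Notation treated := (treated n rk lo).
Notation next_greater := (next_greater n lc SA rk lo hi).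
Notation all_below := (all_below n lc SA rk lo hi).
Notation alive := (on_stack n lc SA rk lo hi).
Notation pops := (pops n lc SA rk lo hi).
Notation potential := (potential n lc SA rk lo hi).
Notation first_after := (first_after n rk lo).
Notation emitted := (emitted n lc).
Notation separated := (separated n rk).

Let lc_sym := lcp_atC w.
Let lc_key' := lc_key lc_sym lc_lt lcp_at_mid rankP SA_range loP hiP.

(** [m2] is the memory before the scan. Output for positions up to [x] matches the old partition
    [lo], for those above [x] the refined one [m2 LO]. The arrays below 4 are [RNK], [LO], [HI] and
    [KEY]. *)
Record scan_inv x s : Prop := ScanInv {
  si_pos : memory s POS 0 = x;
  si_le : x <= n;
  si_same : forall a, a < 4 -> memory s a = m2 a;
  si_size : memory s SIZE = m2 SIZE;
  si_out : size (output s) = n;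
  si_old : forall y, 0 < y <= x ->
    emitted y (separated lo y) (entry [::] (output s) y) (memory s LAST y);
  si_new : forall y, x < y <= n ->
    emitted y (separated (m2 LO) y) (entry [::] (output s) y) (memory s LAST y);
  si_down : forall y, x < y <= n -> next_greater y (memory s DOWN y);
  si_top : forall r, 0 < r <= n -> first_after x r (memory s TOP (hi r)) }.

Record only_at m o x s : Prop := OnlyAt {
  oa_mem : forall a, a != LAST -> a != CAND -> a != TMP -> memory s a = m a;
  oa_last : forall y, y != x -> memory s LAST y = m LAST y;
  oa_size : size (output s) = n;
  oa_out : forall y, 0 < y -> y != x ->
    entry [::] (output s) y = entry [::] o y }.

Lemma wp_emit e m o x k s Q : 0 < x <= n -> x < k -> mates x k ->
  m POS 0 = x -> memory s CAND 0 = k -> safe L I (memory s) e ->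
  denote I (memory s) e %/ 2 = lc x k -> only_at m o x s ->
  emitted x (treated x k) (entry [::] (output s) x) (memory s LAST x) ->
  (forall s', only_at m o x s' -> memory s' CAND = memory s CAND ->
    emitted x (fun k' => treated x k k' \/ k' = k) (entry [::] (output s') x)
      (memory s' LAST x) -> Q s') ->
  wp L I (emit e) Q s.
Proof.
move=> hx xk mk hp hc se de [a1 a2 a3 a4] em hQ.
have ps : memory s POS 0 = x by rewrite a1.
have kn : k <= n by case: mk; lia.
have lcn : lc x k <= n by apply: ltnW; apply: lc_lt; lia.
have em' := treated_emit (@lcp_at_end _ w) rankP loN hx xk mk em.
rewrite /emit /=; reduce; rewrite de ps hc; vc => //.
case: ltnP em' => c em' /=; vc.
- apply: hQ => //=; constructor=> //= a h1 h2 h3.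
  by rewrite (negbTE h3) /= -a1.
have xs : 0 < x <= size (output s) by rewrite a3.
apply: hQ => //=; last first.
  by rewrite entry_push_front ?eqxx ?addn1 //; lia.
constructor=> /=.
- by move=> a h1 h2 h3; rewrite (negbTE h1) (negbTE h3) /= -a1.
- by move=> y ne; rewrite (negbTE ne) a2.
- by rewrite size_push_front.
- move=> y y0 ne; rewrite entry_push_front ?(negbTE ne) ?a4 //; lia.
Qed.

Record pop_inv m o x j s : Prop := PopInv {
  pi_only : only_at m o x s;
  pi_em : emitted x (treated x (none_or_pos n (memory s CAND 0)))
    (entry [::] (output s) x) (memory s LAST x);
  pi_cand : memory s CAND 0 <> 0 -> [/\ x < memory s CAND 0,
    mates x (memory s CAND 0) & alive x (memory s CAND 0)];
  pi_below : all_below x (memory s CAND 0);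
  pi_pops : j = pops x (none_or_pos n (memory s CAND 0)) }.

Lemma key_mem x : 0 < x <= n -> m2 KEY (m2 RNK x) = poskey x.
Proof. by move=> hx; have [hr _] := rankP hx; rewrite rnkE // keyE. Qed.

Lemma rnk_bound x : x <= n -> m2 RNK x < n.+2.
Proof.
case: x => [|x] hx; first by rewrite rnk0.
by rewrite rnkE //; have [h _] := rankP (x := x.+1) hx; lia.
Qed.

Lemma run_pops m o x s : scan_inv x (State m o) -> 0 < x ->
  pop_inv m o x (pops x (none_or_pos n (memory s CAND 0))) s ->
  runs (While pop_guard pop_body) s
    ((max_time pop_body + (cost pop_guard).+1) *
       (pops x (none_or_pos n (memory s CAND 0))).+1)
    (fun s' => (exists j, pop_inv m o x j s') /\
       (memory s' CAND 0 <> 0 -> poskey x <= poskey (memory s' CAND 0))).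
Proof.
move=> si x0 iv; have [/= hp xn hs _ _ _ _ hd _] := si.
have hx : 0 < x <= n by rewrite x0.
set K := max_time pop_body + (cost pop_guard).+1.
apply: (runs_while (Inv := pop_inv m o x) (T := fun j => K * j.+1)) iv.
move=> {s} j s [oa em cand below ->]; have [a1 a2 a3 a4] := oa.
set k := memory s CAND 0 in em cand below *.
have kn : k <= n by case: (eqVneq k 0) => [-> //|/eqP /cand [_ []]]; lia.
have same a : a < 4 -> memory s a = m2 a by move=> c; rewrite a1 ?hs //; lia.
have rk' := same RNK isT; have kk := same KEY isT.
have ps : memory s POS 0 = x by rewrite a1.
have kx := key_mem hx.
(* For [k = 0] nothing is known about the key that is read, but the factor [k] makes the guard 0. *)
have sf : k = 0 \/ 0 < k <= n /\ m2 KEY (m2 RNK k) = poskey k.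
  by case: (eqVneq k 0) => [|k0]; [left|right; rewrite key_mem; lia].
have rb := rnk_bound kn; have rx := rnk_bound xn.
have lt1 : (m2 KEY (m2 RNK k) < poskey x) <= 1 by case: ltnP.
have sg : safe L I (memory s) pop_guard.
  rewrite /pop_guard /key_at /=; reduce; rewrite rk' kk ps -/k kx; vc.
have dg : denote I (memory s) pop_guard = k * (m2 KEY (m2 RNK k) < poskey x).
  by rewrite /pop_guard /key_at /=; reduce; rewrite rk' kk ps -/k kx.
split=> //; rewrite dg; set p := pops _ _.
case: eqP => [stop|go].
  split; last by rewrite /K mulnS; lia.
  split; first by exists p; constructor.
  move=> k0; case: sf => [//|[hk e]].
  by move: stop; rewrite e; case: ltnP => //; rewrite muln1; lia.
have [k0 kxlt] : k <> 0 /\ poskey k < poskey x.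
  case: sf go => [-> //|[hk ->]]; case: ltnP => //; last by rewrite muln0.
  by split=> //; lia.
have [xk mk al] := cand k0.
have hk : 0 < k <= n by case: mk.
exists (max_time pop_body); apply: runs_wp; apply: wp_seq.
have kE : none_or_pos n k = k by apply: none_or_posE; lia.
rewrite kE in em.
have dk : denote I (memory s) (key_at (get CAND)) = poskey k.
  by rewrite /key_at /=; reduce; rewrite rk' kk key_mem.
apply: (@wp_emit _ m o x k) => //.
- by rewrite /key_at /=; reduce; rewrite rk' -/k; vc.
(* The candidate has the smaller key, so half of it is the lcp. *)
- rewrite dk; have := lc_key' hx mk; have -> : x != k by lia.
  by move=> /(_ isT); case: ifP => [|_ ->]; lia.
move=> s' oa' cs em'; have [b1 _ _ _] := oa'.
have nz : next_greater k (memory s' DOWN k).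
  by rewrite b1 //; apply: hd; lia.
rewrite /=; reduce; rewrite cs -/k; vc.
set z := memory s' DOWN k in nz *.
have pz : pops x (none_or_pos n z) < p.
  by rewrite /p kE; exact: pops_next hx mk al kxlt nz.
exists (pops x (none_or_pos n z)); split=> //; last first.
  suff : K + K * (pops x (none_or_pos n z)).+1 <= K * p.+1 by [].
  by rewrite -mulnS leq_mul2l ltnS pz orbT.
constructor=> //=.
- case: oa' => c1 c2 c3 c4; constructor=> //= a h1 h2 h3.
  by rewrite (negbTE h2) c1.
- exact: (treated_next lc_sym lc_lt lcp_at_mid rankP SA_range loP hiP
    hx xk mk kxlt nz em').
- exact: alive_next nz.
- exact: all_below_next nz.
Qed.

Lemma run_scan_body x s : scan_inv x s -> 0 < x ->
  runs scan_body s
    (max_time scan_start +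
     ((max_time pop_body + (cost pop_guard).+1) * (pops x 0).+1 +
      max_time scan_end))
    (scan_inv x.-1).
Proof.
case: s => m o si x0; have [/= hp xn hs hz ho old new hd ht] := si.
have hx : 0 < x <= n by rewrite x0.
have [hr _] := rankP hx.
have [hh _ _] := hiP hr.
have rE : m RNK x = rk x by rewrite hs // rnkE.
have hE : m HI = hi by rewrite hs.
set k := m TOP (hi (rk x)).
have [cand below emk] := first_candidate lc SA hi hx (ht _ hr).
set K := max_time pop_body + (cost pop_guard).+1.
pose s1 := State (update m CAND 0 k) o.
apply: (runs_seq (Q1 := fun s => s = s1)).
  apply: runs_wp; rewrite /scan_start /top_index /=; reduce.
  by rewrite hp rE hE; vc.
move=> _ ->; apply: (runs_seq (Q1 := fun s' => (exists j, pop_inv m o x j s') /\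
    (memory s' CAND 0 <> 0 -> poskey x <= poskey (memory s' CAND 0)))).
  have iv : pop_inv m o x (pops x (none_or_pos n (memory s1 CAND 0))) s1.
    constructor=> //=; last by apply: emk; apply: old; lia.
    by constructor=> //= a h1 h2 h3; rewrite /update (negbTE h2).
  apply: runs_weaken (run_pops si x0 iv) _ _ => //.
  rewrite leq_mul2l ltnS; apply/orP; right; apply: sub_count => y.
  by rewrite /poppable => /and4P[-> -> ->].
move=> s [[j [oa em cd bl _]] stop]; have [a1 a2 a3 a4] := oa.
set c := memory s CAND 0 in em cd bl stop *.
have ps t : only_at m o x t -> memory t POS 0 = x by case=> e *; rewrite e.
have same t a : only_at m o x t -> a < 4 -> memory t a = m2 a.
  by case=> e _ _ _ a4'; rewrite e ?hs //; lia.
have cn : c <= n by case: (eqVneq c 0) => [-> //|/eqP /cd [_ []]]; lia.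
apply: runs_wp; apply: wp_seq; set Q := wp _ _ scan_store _.
(* What each exit of the inner loop must provide before [x] is pushed. *)
have hQ t : only_at m o x t -> next_greater x (memory t CAND 0) ->
    emitted x (separated (m2 LO) x) (entry [::] (output t) x) (memory t LAST x) ->
    Q t.
  move=> ot ngt emt; have [t1 t2 t3 t4] := ot.
  rewrite /Q /scan_store /top_index /prev_pos /=; reduce.
  have tr : memory t RNK = m2 RNK by apply: same.
  have th : memory t HI = m2 HI by apply: same.
  rewrite ps // tr th hiE rnkE // subn1; vc.
  constructor=> //=; try lia.
  - by move=> a ha; have [-> [-> ->]] : (a == 7) = false /\ (a == 4) = false /\
      (a == 5) = false; [lia|exact: same].
  - by rewrite t1.
  - move=> y hy; have ne : y != x by lia.
    have y0 : 0 < y by lia.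
    by rewrite t2 // t4 //; apply: old; lia.
  - move=> y hy; case: (eqVneq y x) => [-> //|ne].
    have y0 : 0 < y by lia.
    by rewrite t2 // t4 //; apply: new; lia.
  - move=> y hy; case: (eqVneq y x) => [-> //|ne].
    by rewrite t1 //; apply: hd; lia.
  (* The write to [TOP] is seen by exactly the ranks in the interval of [x]. *)
  - move=> r hr'; rewrite (hi_lo hiP) // t1 //.
    by apply: first_after_step => // _; apply: ht.
have sr := same s RNK oa isT; have sk := same s KEY oa isT.
have sp := ps s oa.
move: Q hQ => Q hQ; apply: wp_if; first by rewrite /=; reduce; vc.
  move=> c0; have {}c0 : c <> 0 by []; have [xc mc al] := cd c0; have kx := stop c0.
  have hc : 0 < c <= n by case: mc.
  have cE : none_or_pos n c = c by apply: none_or_posE; lia.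
  rewrite cE in em.
  have dg k' : 0 < k' <= n -> memory s KEY (memory s RNK k') = poskey k'.
    by move=> hk; rewrite sr sk key_mem.
  have rc := rnk_bound cn; have rx := rnk_bound xn.
  have dE : denote I (memory s) (eq_expr (key_at (get CAND)) (key_at (get POS))) =
      (poskey c == poskey x) by rewrite /= -/c sp !dg.
  apply: wp_if; rewrite ?dE; first by rewrite /=; reduce; rewrite -/c sp sr; vc.
  (* Equal keys: the candidate is in the run of [x] and is left to later rounds. *)
  - case: eqP => // e _; rewrite /=; reduce; rewrite -/c; vc.
    have nz : next_greater c (memory s DOWN c) by rewrite a1 //; apply: hd; lia.
    apply: hQ => //=.
    + constructor=> //= a h1 h2 h3.
      by rewrite (negbTE h2) /= -a1.
    + exact: (next_greater_equal x0 xc mc e bl nz).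
    + apply: (treated_stop lc_sym lc_lt lcp_at_mid rankP SA_range loP hiP refP
        hx xc mc kx bl).
      by apply: emitted_ext em => y _; split=> [|[//|[_ ne]]]; [left|].
  (* A larger key: now the key of [x] is the minimum and gives the lcp. *)
  - case: eqP => // ne _; apply: (@wp_emit _ m o x c) => //.
    + by rewrite /key_at /=; reduce; rewrite sr sp; vc.
    + rewrite /key_at /= sp dg //.
      have := lc_key' hx mc; have -> : x != c by lia.
      by move=> /(_ isT); case: eqP => [e|_ ->]; lia.
    move=> t ot tc emt; apply: hQ => //.
      by rewrite tc -/c; apply: next_greater_stop => // _; split=> //; lia.
    apply: (treated_stop lc_sym lc_lt lcp_at_mid rankP SA_range loP hiP refP
      hx xc mc kx bl).
    apply: emitted_ext emt => y _; split=> [[|->]|[|[-> _]]];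
      [by left|by right; split=> //; apply/nesym|by left|by right].
move=> c0; have {}c0 : c = 0 by []; rewrite c0 in bl em; apply: hQ => //.
  by rewrite -/c c0; apply: next_greater_stop.
exact: (treated_all lc_sym lc_lt lcp_at_mid rankP SA_range loP hiP refP hx bl em).
Qed.

(** Each stack entry carries the credit [D] for its own removal, and [potential_step] shows that a
    position need only bring the credit of one entry. *)
Lemma run_scan_loop s : scan_inv n s ->
  runs (While (get POS) scan_body) s (scan_time * n + 3) (scan_inv 0).
Proof.
move=> iv; pose D := max_time pop_body + (cost pop_guard).+1.
have pn : potential n = 0.
  apply/eqP; rewrite -leqn0 leqNgt -has_count; apply/hasPn => y.
  by rewrite mem_iota /on_stack; case: ltnP => //; lia.
have -> : scan_time * n + 3 = scan_time * n + D * potential n + 3.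
  by rewrite pn muln0 addn0.
apply: (runs_while (Inv := scan_inv)
  (T := fun x => scan_time * x + D * potential x + 3)) iv.
move=> {s} x s iv; split; first by rewrite /=; reduce; vc.
rewrite [denote _ _ _]/= (si_pos iv); case: eqP => [x0|/eqP nx].
  by split; [rewrite -x0|exact: leq_addl].
have x0 : 0 < x by lia.
have hx : 0 < x <= n by rewrite x0; exact: si_le iv.
eexists; apply: runs_weaken (run_scan_body iv x0) (leqnn _) _ => s' iv'.
exists x.-1; split=> //; first by lia.
have := potential_step lc SA rk lo hi hx.
rewrite -(leq_pmul2l (_ : 0 < D)) // mulnDr mulnS.
have -> : scan_time * x = scan_time + scan_time * x.-1 by rewrite -mulnS prednK.
have : scan_time = max_time scan_start + max_time scan_end + 2 * D + 3 by [].
rewrite -/D mulnS; change (cost (get POS)) with 2.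
move: (max_time scan_start) (max_time scan_end) D => e1 e2 D.
move: (D * potential x) (D * potential x.-1) (D * pops x 0) => p1 p2 p3.
by move: scan_time (scan_time * x.-1) => t1 t2; lia.
Qed.
End Scan.

(** * The rounds and the final output *)

Lemma run_round sz s : round_inv sz s -> 1 < sz ->
  runs round s (round_time n) (round_inv (sz %/ 2)).
Proof.
move=> ri sz1; apply: (runs_seq (run_left ri)) => s1 li.
apply: (runs_seq (run_right ri li)) => s2 ti.
set m2 := memory s2; set lo := memory s LO; set hi := memory s1 HI.
have [hs hsz hr hz hi' hn hsm he ho hem] := ri.
have [_ _ l1 l2 l3 l4 lo1 lh lt _ _] := li.
have [_ _ t1 t2 t3 t4 t5 to tl tr tk _] := ti.
have hiP r : 0 < r <= n -> last_of n lo r (hi r) by apply: lh.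
have refP r : 0 < r <= n -> refines n lc SA lo hi (m2 LO) r.
  by move=> hr'; apply: tr; lia.
have rnkE x : 0 < x <= n -> m2 RNK x = rk x by move=> hx; rewrite /m2 t1 l1 hr.
have rnk0 : m2 RNK 0 = 0 by rewrite /m2 t1 l1.
have keyE q : 0 < q <= n -> m2 KEY q = key lo hi q.
  by move=> hq; apply: tk => //; left; lia.
have scan : runs scan_loop s2 (3 + (scan_time * n + 3)) (scan_inv m2 lo hi 0).
  apply: (runs_seq (Q1 := scan_inv m2 lo hi n)); last first.
    by move=> s3; apply: run_scan_loop.
  apply: runs_wp; rewrite /=; reduce; vc.
  constructor=> //=; try by lia.
  - by move=> a ha; have -> : (a == 7) = false by lia.
  - by rewrite to.
  - by move=> y hy; rewrite to t4 l3; apply: hem.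
  - move=> r hr'; have [hb _ _] := hiP r hr'.
    by rewrite t3 lt; [split=> // u; rewrite /none_or_pos /=; lia|lia].
apply: (runs_seq scan) => s3 [_ _ sa sb sc _ sd _ _].
have LOE : memory s3 LO = m2 LO by rewrite sa.
have RNE : memory s3 RNK = m2 RNK by rewrite sa.
apply: runs_wp; rewrite /=; reduce.
have SE : memory s3 SIZE 0 = sz by rewrite sb /m2 t5 l4.
rewrite SE; vc.
constructor=> /=; rewrite ?RNE ?LOE //; try by lia.
- exact: refines_intervals refP.
- exact: (refines_nested (lcp_atC w) lc_lt lcp_at_mid SA_range hi' hn hiP refP).
- exact: (refines_small (lcp_atC w) lc_lt lcp_at_mid SA_range hi' hiP refP hsm).
- by rewrite /m2 tl ?leqnn.
Qed.

Lemma run_rounds sz s : round_inv sz s ->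
  runs (While (lt_expr (Const 1) (get SIZE)) round) s
    ((round_time n + 5) * (trunc_log 2 sz).+1)
    (fun s' => exists sz', sz' <= 1 /\ round_inv sz' s').
Proof.
move=> ri; apply: (runs_while (Inv := round_inv)
  (T := fun sz => (round_time n + 5) * (trunc_log 2 sz).+1)) ri.
move=> {s} {}sz s ri; have [hs hn _ _ _ _ _ _ _ _] := ri.
split; rewrite /=; reduce; rewrite hs; first by vc.
case: ltnP => c /=; last first.
  by split; [exists sz|rewrite mulnS; lia].
exists (round_time n); apply: runs_weaken (run_round ri c) (leqnn _) _ => s' ri'.
exists (sz %/ 2); split=> //; first by lia.
(* Halving [sz > 1] lowers its logarithm by exactly one, which pays for a round and its test. *)
by rewrite -addnA -[4.+1]/5 addnA -mulnS [in leqRHS]trunc_log2S // divn2.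
Qed.

(** All intervals are singletons, so every record is separated and has been output. *)
Lemma round_inv_MRC sz s : sz <= 1 -> round_inv sz s -> is_MRC_array w (output s).
Proof.
move=> sz1 [_ _ _ _ _ _ sm _ so em]; split=> // i iw.
have hi : 0 < i <= n by [].
have [srt mo _ _] := em i hi; split=> // l c.
rewrite mo; split.
  by case=> k [rk' _ -> ->]; apply/MRC_pairP => //; exists k.
case/(MRC_pairP _ _ iw) => k [rk' -> ->]; exists k; split=> // -[hk e].
have [ri si] := rankP hi; have [rk2 sk] := rankP hk; case: rk' => ik _.
case: (ltngtP (rk i) (rk k)) => c2.
- by have := sm (rk i) (rk k); rewrite e; lia.
- by have := sm (rk k) (rk i); rewrite e; lia.
- by move: ik; rewrite -{1}si c2 sk; lia.
Qed.

Lemma run_mrc_program :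
  runs mrc_program (initial_state n) (total_time n)
    (fun s => is_MRC_array w (output s)).
Proof.
apply: (runs_seq run_init) => s ii.
apply: (runs_seq (run_init_end ii)) => s' ri.
by apply: runs_weaken (run_rounds ri) (leqnn _) _ => t [sz [/round_inv_MRC H /H]].
Qed.

End Program.

(** * Asymptotic bounds *)

Lemma bigO_loglinear T a b c d :
  (forall n, T n <= a + b * n.+1 + (c + d * n.+1) * (trunc_log 2 n).+1) ->
  bigO T (fun n => n * trunc_log 2 n).
Proof.
(* From n = 2 on, the logarithm is at least 1, so each of the two successors at most doubles its
   argument. *)
move=> hT; exists (a + 2 * b + 2 * c + 4 * d), 2 => n n2.
apply: leq_trans (hT n) _.
have t0 : 0 < trunc_log 2 n by rewrite trunc_log_gt0.
move: (trunc_log 2 n) t0 => t t0.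
have [k ->] : exists k, n = k.+1 by exists n.-1; lia.
have [u ->] : exists u, t = u.+1 by exists t.-1; lia.
nia.
Qed.

Lemma total_time_bigO : bigO total_time (fun n => n * trunc_log 2 n).
Proof.
(* 17 is four times 3 from [round_time] plus 5 for the outer test; 10 adds the loop tests 3 and
   7. *)
apply: (@bigO_loglinear _ (3 + max_time init_end) (max_time init_body + 3)
  (17 + max_time (set SIZE (half (get SIZE))))
  (max_time left_body + max_time right_body + scan_time + 10)) => n.
have hR : round_time n + 5 <= 17 + max_time (set SIZE (half (get SIZE))) +
    (max_time left_body + max_time right_body + scan_time + 10) * n.+1.
  rewrite /round_time; move: (max_time _) (max_time _) (max_time _) scan_time.
  by move=> c1 c2 c3 c4; lia.
have := leq_mul hR (leqnn (trunc_log 2 n).+1); rewrite /total_time.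
move: (max_time init_end) (max_time init_body) => c1 c2.
by move: (_ * (trunc_log 2 n).+1) (_ * (trunc_log 2 n).+1) => c3 c4; lia.
Qed.

Theorem theorem2 :
  exists (P : cmd) (T S b : nat -> nat),
    [/\ bigO T (fun n => n * trunc_log 2 n),
        bigO S (fun n => n),
        bigO b (fun n => trunc_log 2 n) &
        forall (d : Order.disp_t) (A : orderType d) (w : seq A)
               (SA LCP : seq nat),
          is_suffix_array w SA ->
          is_lcp_array w SA LCP ->
          exists M : seq (seq (nat * nat)),
            is_MRC_array w M /\
            computes_within P (Input w SA LCP) M
              (T (size w)) (S (size w)) (b (size w))].
Proof.
(* Seven arrays of n + 2 cells and five scalars. The six extra bits give words beyond [32 * n],
   enough for keys and sums. *)
exists mrc_program, total_time, (fun n => 7 * n.+2 + 5), (fun n => trunc_log 2 n + 6).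
split.
- exact: total_time_bigO.
- by exists 26, 1 => n; lia.
- exists 7, 2 => n n2; have t0 : 0 < trunc_log 2 n by rewrite trunc_log_gt0.
  by lia.
move=> d A w SA LCP saP lcpP.
have bP v : v <= 4 * size w + 15 -> v < 2 ^ (trunc_log 2 (size w) + 6).
  have := trunc_log_ltn (size w) (isT : 1 < 2).
  have -> : 2 ^ (trunc_log 2 (size w) + 6) = 2 ^ 5 * 2 ^ (trunc_log 2 (size w)).+1.
    by rewrite -expnD; congr (2 ^ _); lia.
  by move: (2 ^ (trunc_log _ _).+1) => e; rewrite -[2 ^ 5]/32; lia.
have [t [s [ex tb sM]]] := run_mrc_program saP lcpP bP.
exists (output s); split=> //.
exists (mem_layout w), t, s; split=> //.
by rewrite sumn_cat !sumn_nseq; lia.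
Qed.
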